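(* Let $(k_n)_{n\ge 0}$ be a sequence of natural numbers $k_n\ge 2$ and let $G=\bigcup_{n\in\mathbb N}G_n$ be the corresponding SD$\mathcal S$-group, where $G_n=\operatorname{Sym}(X_n)$ and $X_n=\prod_{0\le m\le n}[k_m]$. If $G$ is simple, then the ergodic invariant random subgroups of $G$ are $$\{\delta_{1},\delta_{G}\}\cup\{\sigma_r\mid r\in\mathbb N^{+}\}.$$ If $G$ is not simple, then the ergodic invariant random subgroups of $G$ are $$\{\delta_{1},\delta_{A(G)},\delta_{G}\}\cup\{\sigma_r\mid r\in\mathbb N^{+}\}\cup\{\tilde\sigma_r\mid r\in\mathbb N^{+}\}.$$
   Context: For a countable discrete group $G$, $\mathrm{Sub}_G$ is the compact space of subgroups of $G$ (a closed subspace of $\{0,1\}^G$). An invariant random subgroup (IRS) of $G$ is a Borel probability measure on $\mathrm{Sub}_G$ invariant under the conjugation action of $G$; it is ergodic if it is ergodic for this action. For a normal subgroup $N\trianglelefteq G$, $\delta_N$ is the Dirac measure at $N$; $\delta_1$ is the Dirac measure at the trivial subgroup. If $G$ acts by measure preserving maps on a Borel probability space $(Z,\mu)$, the stabilizer distribution is the IRS $f_*\mu$, where $f(z)=G_z=\{g\in G\mid g\cdot z=z\}$. SD$\mathcal S$-groups: write $[k]=\{0,1,\dots,k-1\}$. Given a sequence $(k_n)_{n\ge0}$ of natural numbers $k_n\ge2$, let $X_n=\prod_{0\le m\le n}[k_m]$, $G_n=\operatorname{Sym}(X_n)$, and let $\varphi_n:G_n\to G_{n+1}$ be the embedding $\varphi_n(g)\cdot(i_0,\dots,i_n,i_{n+1})=(g(i_0,\dots,i_n),i_{n+1})$.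 The corresponding SD$\mathcal S$-group (strictly diagonal limit of finite symmetric groups) is the union (direct limit) $G=\bigcup_n G_n$, with $G_n$ identified with its image in $G_{n+1}$ via $\varphi_n$. Let $X=\prod_{n\ge0}[k_n]$ and let $\mu$ be the product of the uniform probability measures on the sets $[k_n]$. $G$ acts on $(X,\mu)$ by measure preserving maps via $g\cdot(i_0,\dots,i_n,i_{n+1},\dots)=(g(i_0,\dots,i_n),i_{n+1},\dots)$ for $g\in G_n$. For $r\in\mathbb N^+$, $\sigma_r$ is the stabilizer distribution of the diagonal action of $G$ on $(X^r,\mu^{\otimes r})$; i.e. the push-forward of $\mu^{\otimes r}$ under $\bar x=(x_0,\dots,x_{r-1})\mapsto G_{\bar x}=\{g\in G\mid g\cdot x_i=x_i\text{ for }0\le i<r\}$. $G$ is simple if and only if $k_n$ is even for infinitely many $n$. If $k_n$ is odd for all but finitely many $n$, then $A(G)=\bigcup_{n}\operatorname{Alt}(X_n)$ is a simple subgroup of index $2$ in $G$, and $\tilde\sigma_r$ denotes the push-forward of $\mu^{\otimes r}$ under $\bar x\mapsto G_{\bar x}\cap A(G)$. *)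

(* Defs.v *)
From HB Require Import structures.
From mathcomp Require Import all_boot all_order all_algebra all_fingroup.
From mathcomp Require Import all_solvable.
From mathcomp Require Import all_classical all_reals all_analysis.

Set Implicit Arguments.
Unset Strict Implicit.
Unset Printing Implicit Defensive.

Import Order.TTheory GRing.Theory Num.Theory.
Import numFieldNormedType.Exports.

Local Open Scope classical_set_scope.
Local Open Scope group_scope.
Local Open Scope quotient_scope.

Section DirectLimit.
Variable H : nat -> groupType.
Variable phi : forall n, {multiplicative H n -> H n.+1}.

Definition dl_pre := {n : nat & H n}.
HB.instance Definition _ := Choice.on dl_pre.

Definition dl_next (s : dl_pre) : dl_pre :=
  Tagged (fun n => H n) (phi (tag s) (tagged s)).

(* Two elements are identified when they have a common iterated image under
   the maps [phi]. *)
Definition dl_equiv (s t : dl_pre) : bool :=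
  `[< exists p q, iter p dl_next s = iter q dl_next t >].

Lemma dl_equiv_refl : reflexive dl_equiv.
Proof. by move=> s; apply/asboolP; exists 0%N, 0%N. Qed.

Lemma dl_equiv_sym : symmetric dl_equiv.
Proof.
by move=> s t; apply/asboolP/asboolP => -[p [q e]]; exists q, p.
Qed.

Lemma dl_equiv_trans : transitive dl_equiv.
Proof.
move=> t s u /asboolP[p [q e]] /asboolP[p' [q' e']]; apply/asboolP.
exists (p' + p)%N, (q + q')%N.
by rewrite !iterD e -e' -!iterD addnC.
Qed.

Canonical dl_equiv_rel :=
  EquivRel dl_equiv dl_equiv_refl dl_equiv_sym dl_equiv_trans.

Definition dirlim := {eq_quot dl_equiv_rel}.
HB.instance Definition _ := Choice.on dirlim.
HB.instance Definition _ := EqQuotient.on dirlim.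

Definition dl_in n (x : H n) : dirlim := \pi_dirlim (Tagged (fun n => H n) x).

Lemma dl_in_phi n (x : H n) : dl_in (phi n x) = dl_in x.
Proof. by apply/eqmodP/asboolP; exists 0%N, 1%N. Qed.

Lemma dl_in_surj g : exists n (x : H n), g = dl_in x.
Proof.
exists (tag (generic_quotient.repr g)), (tagged (generic_quotient.repr g)).
by rewrite /dl_in taggedK reprK.
Qed.

(* The image of [s] in [H m]; it is only meaningful when [tag s <= m]. *)
Definition dl_at m (s : dl_pre) : H m :=
  @untag _ (fun n => H n) _ 1 m id (iter (m - tag s) dl_next s).

Lemma tag_iter p s : tag (iter p dl_next s) = (p + tag s)%N.
Proof. by elim: p => //= p ->. Qed.

Lemma dl_atE m s : (tag s <= m)%N ->
  Tagged (fun n => H n) (dl_at m s) = iter (m - tag s) dl_next s.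
Proof.
move=> sm; rewrite /dl_at.
have e : tag (iter (m - tag s) dl_next s) = m by rewrite tag_iter subnK.
by rewrite (untagE _ _ e) etaggedK.
Qed.

Lemma dl_at_tagged n (x : H n) : dl_at n (Tagged (fun n => H n) x) = x.
Proof.
apply: (@eq_from_Tagged _ (fun n => H n)).
by rewrite dl_atE//= subnn.
Qed.

Lemma dl_atS m s : (tag s <= m)%N -> dl_at m.+1 s = phi m (dl_at m s).
Proof.
move=> sm; apply: (@eq_from_Tagged _ (fun n => H n)).
by rewrite dl_atE ?leqW// subSn// iterS -dl_atE.
Qed.

Lemma dl_in_at m s : (tag s <= m)%N -> dl_in (dl_at m s) = \pi_dirlim s.
Proof.
move=> sm; rewrite /dl_in dl_atE//; apply/eqmodP/asboolP.
by exists 0%N, (m - tag s)%N.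
Qed.

Lemma dl_in_eq n m (x : H n) (y : H m) : dl_in x = dl_in y ->
  exists N, [/\ (n <= N)%N, (m <= N)%N &
    dl_at N (Tagged (fun n => H n) x) = dl_at N (Tagged (fun n => H n) y)].
Proof.
move=> /eqmodP/asboolP[p [q e]]; exists (p + n)%N.
have e' : (p + n = q + m)%N by have := congr1 tag e; rewrite !tag_iter.
have mN : (m <= p + n)%N by rewrite e' leq_addl.
split; rewrite ?leq_addl//.
apply: (@eq_from_Tagged _ (fun n => H n)).
by rewrite !dl_atE//= ?leq_addl// addnK e' addnK.
Qed.

Definition dl_mul (g h : dirlim) : dirlim :=
  let s := generic_quotient.repr g in let t := generic_quotient.repr h in
  let m := maxn (tag s) (tag t) in dl_in (dl_at m s * dl_at m t).

Definition dl_inv (g : dirlim) : dirlim :=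
  dl_in (tagged (generic_quotient.repr g))^-1.

Definition dl_one : dirlim := dl_in (1 : H 0).

Lemma phi1 n : phi n 1 = 1.
Proof. by apply: (mulgI (phi n 1)); rewrite -gmulfM !mulg1. Qed.

Lemma phiV n x : phi n x^-1 = (phi n x)^-1.
Proof. by apply: (mulgI (phi n x)); rewrite -gmulfM !mulgV phi1. Qed.

Lemma dl_in_at_mul m p s t : (tag s <= m)%N -> (tag t <= m)%N ->
  dl_in (dl_at (p + m) s * dl_at (p + m) t) = dl_in (dl_at m s * dl_at m t).
Proof.
move=> sm tm; elim: p => // p <-; rewrite addSn.
by rewrite !dl_atS ?(leq_trans _ (leq_addl _ _))// -gmulfM dl_in_phi.
Qed.

Lemma dl_at_eq N m s t : (tag s <= N)%N -> (tag t <= N)%N -> (N <= m)%N ->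
  dl_at N s = dl_at N t -> dl_at m s = dl_at m t.
Proof.
move=> sN tN /subnK <- e; elim: (m - N)%N => // p IH.
by rewrite addSn !dl_atS ?(leq_trans _ (leq_addl _ _))// IH.
Qed.

Lemma dl_inM n (x y : H n) : dl_in (x * y) = dl_mul (dl_in x) (dl_in y).
Proof.
have rE (z : H n) : exists N, [/\ (n <= N)%N,
    (tag (generic_quotient.repr (dl_in z)) <= N)%N &
    dl_at N (Tagged (fun n => H n) z) = dl_at N (generic_quotient.repr (dl_in z))].
  have : dl_in z = dl_in (tagged (generic_quotient.repr (dl_in z))).
    by rewrite [RHS]/dl_in taggedK reprK.
  by move=> /dl_in_eq[N [nN rN]]; rewrite taggedK => e; exists N.
have [N [nN xN xE]] := rE x; have [M [nM yM yE]] := rE y.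
rewrite /dl_mul; set s := generic_quotient.repr _ in xN xE *.
set t := generic_quotient.repr _ in yM yE *; set m := maxn _ _.
set K := (N + M + m)%N.
have NK : (N <= K)%N by rewrite /K -addnA leq_addr.
have MK : (M <= K)%N by rewrite /K addnAC leq_addl.
rewrite -(@dl_in_at_mul m (N + M))// ?leq_maxl ?leq_maxr// -/K.
rewrite -(dl_at_eq _ _ NK xE)// -(dl_at_eq _ _ MK yE)//.
have nK : (n <= K)%N := leq_trans nN NK.
rewrite -(subnK nK) dl_in_at_mul//.
by rewrite !dl_at_tagged.
Qed.

Lemma dl_inV n (x : H n) : dl_in x^-1 = dl_inv (dl_in x).
Proof.
rewrite /dl_inv; set s := generic_quotient.repr _.
have : dl_in x = dl_in (tagged s) by rewrite [RHS]/dl_in taggedK reprK.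
move=> /dl_in_eq[N [/subnK nN /subnK sN]].
have atV p k (z : H k) : dl_in (dl_at (p + k) (Tagged (fun n => H n) z))^-1 = dl_in z^-1.
  elim: p => [|p <-]; first by rewrite dl_at_tagged.
  by rewrite addSn dl_atS ?leq_addl// -phiV dl_in_phi.
by rewrite -(atV (N - n)%N _ x) -(atV (N - tag s)%N _ (tagged s)) nN sN => ->.
Qed.

Lemma dl_in1 n : dl_in (1 : H n) = dl_one.
Proof. by elim: n => // n <-; rewrite -phi1 dl_in_phi. Qed.

Lemma dl_in_common n (x : H n) p :
  exists y : H (p + n), dl_in x = dl_in y.
Proof.
elim: p => [|p [y ->]]; first by exists x.
by exists (phi _ y); rewrite dl_in_phi.
Qed.

Lemma dl_in_le (g : dirlim) : exists n, forall m, (n <= m)%N ->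
  exists x : H m, g = dl_in x.
Proof.
have [n [x ->]] := dl_in_surj g; exists n => m /subnK <-.
exact: dl_in_common.
Qed.

Lemma dl_mulA : associative dl_mul.
Proof.
move=> f g h.
have [a fa] := dl_in_le f; have [b gb] := dl_in_le g.
have [c hc] := dl_in_le h; pose m := (a + b + c)%N.
have [x ->] := fa m (leq_trans (leq_addr _ _) (leq_addr _ _)).
have [y ->] := gb m (leq_trans (leq_addl _ _) (leq_addr _ _)).
have [z ->] := hc m (leq_addl _ _).
by rewrite -!dl_inM mulgA.
Qed.

Lemma dl_mul1g : left_id dl_one dl_mul.
Proof.
by move=> g; have [n [x ->]] := dl_in_surj g; rewrite -(dl_in1 n) -dl_inM mul1g.
Qed.

Lemma dl_mulg1 : right_id dl_one dl_mul.
Proof.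
by move=> g; have [n [x ->]] := dl_in_surj g; rewrite -(dl_in1 n) -dl_inM mulg1.
Qed.

Lemma dl_mulVg : left_inverse dl_one dl_inv dl_mul.
Proof.
move=> g; have [n [x ->]] := dl_in_surj g.
by rewrite -dl_inV -dl_inM mulVg dl_in1.
Qed.

Lemma dl_mulgV : right_inverse dl_one dl_inv dl_mul.
Proof.
move=> g; have [n [x ->]] := dl_in_surj g.
by rewrite -dl_inV -dl_inM mulgV dl_in1.
Qed.

HB.instance Definition _ := isGroup.Build dirlim
  dl_mulA dl_mul1g dl_mulg1 dl_mulVg dl_mulgV.

HB.instance Definition _ n :=
  isMultiplicative.Build (H n) dirlim (@dl_in n) (@dl_inM n).

End DirectLimit.

Record branching := Branching {
  br :> nat -> nat;
  br_ge2 : forall n, (2 <= br n)%N }.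

Section SDSGroup.
Variable k : branching.

(* [level n] is [k_0] * ... * [k_n]. *)
Fixpoint level (n : nat) : finType :=
  if n is m.+1 then (level m * 'I_(k m.+1))%type : finType else 'I_(k 0).

Definition stretch_fun n (g : {perm level n}) (w : level n.+1) : level n.+1 :=
  (g w.1, w.2).

Lemma stretch_fun_inj n (g : {perm level n}) : injective (stretch_fun g).
Proof. by move=> [w i] [w' i'] [/perm_inj -> ->]. Qed.

Definition stretch n (g : {perm level n}) : {perm level n.+1} :=
  perm (@stretch_fun_inj n g).

Lemma stretchM n : {morph @stretch n : g h / g * h}.
Proof.
by move=> g h; apply/permP => -[w i]; rewrite permM !permE /stretch_fun /= permM.
Qed.

HB.instance Definition _ n := isMultiplicative.Build
  {perm level n} {perm level n.+1} (@stretch n) (@stretchM n).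

Definition SDS :=
  dirlim (H := fun n => {perm level n} : groupType) (fun n => @stretch n).
HB.instance Definition _ := monoid.Group.on SDS.
HB.instance Definition _ := EqQuotient.on SDS.

End SDSGroup.
Arguments SDS : clear implicits.

Section Action.
Variable k : branching.

Lemma br_gt0 n : (0 < k n)%N.
Proof. exact: leq_trans (br_ge2 k n). Qed.

Definition seqspace : Type := forall n, 'I_(k n).
HB.instance Definition _ := gen_eqMixin seqspace.
HB.instance Definition _ := gen_choiceMixin seqspace.
HB.instance Definition _ :=
  isPointed.Build seqspace (fun n => Ordinal (br_gt0 n)).

Fixpoint prefix n : seqspace -> level k n :=
  match n return seqspace -> level k n with
  | 0 => fun x => x 0
  | m.+1 => fun x => (prefix m x, x m.+1)
  end.

(* [graft w x] is [x] with its first coordinates replaced by those of [w]. *)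
Fixpoint graft n : level k n -> seqspace -> seqspace :=
  match n return level k n -> seqspace -> seqspace with
  | 0 => fun w x => @dfwith _ (fun i => 'I_(k i)) x 0 w
  | m.+1 => fun w x => @dfwith _ (fun i => 'I_(k i)) (graft w.1 x) m.+1 w.2
  end.

Lemma graft_out n (w : level k n) x m : (n < m)%N -> graft w x m = x m.
Proof.
elim: n w => [w|n IH [w i]] nm /=; first by rewrite dfwithout// eq_sym -lt0n.
by rewrite dfwithout ?IH// ?(ltnW nm)// neq_ltn nm.
Qed.

Lemma eq_prefix n x y :
  prefix n x = prefix n y <-> forall i, (i <= n)%N -> x i = y i.
Proof.
elim: n => [|n IH] /=.
  by split=> [e [|//] _|]; [exact: e|apply].
split=> [[/IH e en] i|e].
  by rewrite leq_eqVlt => /predU1P[->//|]; rewrite ltnS => /e.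
by congr (_, _); [apply/IH => i /leqW/e|exact: e].
Qed.

Lemma prefix_graft n (w : level k n) x : prefix n (graft w x) = w.
Proof.
elim: n w => [|n IH] /= w; first by rewrite dfwithin.
rewrite dfwithin; case: w => w i /=; congr (_, _); rewrite -[RHS]IH.
by apply/eq_prefix => m mn; rewrite dfwithout// neq_ltn ltnS mn orbT.
Qed.

Lemma seqspace_ext n x y : prefix n x = prefix n y ->
  (forall m, (n < m)%N -> x m = y m) -> x = y.
Proof.
move=> /eq_prefix xy1 xy2; apply: functional_extensionality_dep => m.
by have [/xy1|/xy2] := leqP m n.
Qed.

Definition act_level n (g : {perm level k n}) (x : seqspace) : seqspace :=
  graft (g (prefix n x)) x.

Lemma act_level_stretch n (g : {perm level k n}) x :
  act_level (stretch g) x = act_level g x.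
Proof.
rewrite /act_level; apply: (@seqspace_ext n.+1) => [|m nm]; last by rewrite !graft_out// ltnW.
rewrite prefix_graft permE /=; congr (_, _); first by rewrite prefix_graft.
by rewrite graft_out.
Qed.

Lemma act_levelM n (g h : {perm level k n}) x :
  act_level (g * h) x = act_level h (act_level g x).
Proof.
rewrite /act_level; apply: (@seqspace_ext n) => [|m nm]; last by rewrite !graft_out.
by rewrite !prefix_graft permM.
Qed.

Lemma act_level1 n x : act_level (1 : {perm level k n}) x = x.
Proof.
rewrite /act_level; apply: (@seqspace_ext n) => [|m nm]; last by rewrite !graft_out.
by rewrite prefix_graft perm1.
Qed.

Definition act (g : SDS k) (x : seqspace) : seqspace :=
  act_level (tagged (generic_quotient.repr g)) x.

Lemma act_in n (g : {perm level k n}) x :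
  act (dl_in _ g : SDS k) x = act_level g x.
Proof.
have it p s : act_level (tagged (iter p 
      (@dl_next (fun n => {perm level k n} : groupType) (fun n => @stretch k n)) s)) x
    = act_level (tagged s) x.
  by elim: p => //= p <-; rewrite act_level_stretch.
rewrite /act; set s := generic_quotient.repr _.
have /eqmodP/asboolP[p [q e]] : \pi_(SDS k) s = dl_in _ g.
  by rewrite reprK.
by rewrite -(it p s) e it.
Qed.

Lemma SDS_common (g h : SDS k) : exists n (a b : {perm level k n}),
  g = dl_in _ a /\ h = dl_in _ b.
Proof.
have [n gn] := dl_in_le g; have [m hm] := dl_in_le h.
have [a ->] := gn (n + m)%N (leq_addr _ _).
have [b ->] := hm (n + m)%N (leq_addl _ _).
by exists (n + m)%N, a, b.
Qed.

(* Permutations of a finite type are composed from left to right in the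
   library, so that [act] is a right action. *)
Lemma actM (g h : SDS k) x : act (g * h) x = act h (act g x).
Proof.
have [n [a [b [-> ->]]]] := SDS_common g h.
by rewrite -gmulfM !act_in act_levelM.
Qed.

Lemma act1 x : act 1 x = x.
Proof. by rewrite [1](_ : _ = dl_in _ (1 : {perm level k 0}))// act_in act_level1. Qed.

End Action.

Section Subgroups.
Variable G : groupType.

Definition Sub : Type := set_type [set H : {ptws G -> bool} | group_closed H].
HB.instance Definition _ := Topological.on Sub.

Definition mk_sub (H : G -> bool) (HG : group_closed H) : Sub :=
  exist _ H (mem_set HG).

Definition sub_mem (H : Sub) : {pred G} := (set_val H : G -> bool).

Lemma sub_closed (H : Sub) : group_closed (sub_mem H).
Proof. exact: set_mem (valP H). Qed.

Lemma trivial_closed : group_closed (fun x : G => x == 1).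
Proof.
split=> [|x y]; first exact: eqxx.
by rewrite !unfold_in => /eqP-> /eqP->; rewrite divgg.
Qed.

Lemma whole_closed : group_closed (fun _ : G => true).
Proof. by []. Qed.

Definition triv_sub : Sub := mk_sub trivial_closed.
Definition whole_sub : Sub := mk_sub whole_closed.

HB.instance Definition _ := isPointed.Build Sub triv_sub.

Lemma conj_closed (g : G) (H : Sub) :
  group_closed (fun x => x ^ g \in sub_mem H).
Proof.
have [H1 HB] := sub_closed H; split=> [|x y]; rewrite !unfold_in /=.
  by rewrite conj1g.
by move=> Hx Hy; rewrite conjMg conjVg; exact: HB.
Qed.

(* [x ^ g] is [g^-1 * x * g], so this is the subgroup [g * H * g^-1]. *)
Definition conj_sub (g : G) (H : Sub) : Sub := mk_sub (conj_closed g H).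

Lemma cap_closed (H K : Sub) :
  group_closed (fun x => (x \in sub_mem H) && (x \in sub_mem K)).
Proof.
have [H1 HB] := sub_closed H; have [K1 KB] := sub_closed K.
split=> [|x y]; rewrite !unfold_in /=.
  by apply/andP.
by move=> /andP[Hx Kx] /andP[Hy Ky]; apply/andP; split; [exact: HB|exact: KB].
Qed.

Definition cap_sub (H K : Sub) : Sub := mk_sub (cap_closed H K).

Definition normal_sub (N : Sub) : Prop := forall g, conj_sub g N = N.

Definition simple_group : Prop :=
  triv_sub <> whole_sub /\
  forall N : Sub, normal_sub N -> N = triv_sub \/ N = whole_sub.

(* [Sub] with its Borel sigma-algebra. *)
Definition BSub := g_sigma_algebraType (@open Sub).
HB.instance Definition _ := Measurable.on BSub.

End Subgroups.
Arguments Sub : clear implicits.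
Arguments BSub : clear implicits.
Arguments triv_sub : clear implicits.
Arguments whole_sub : clear implicits.
Arguments simple_group : clear implicits.

Section IRS.
Local Open Scope ereal_scope.
Variables (R : realType) (G : groupType).

Definition IRS (lambda : probability (BSub G) R) : Prop :=
  forall (g : G) (A : set (BSub G)), measurable A ->
    pushforward lambda (conj_sub g : BSub G -> BSub G) A = lambda A.

Definition ergodic_IRS (lambda : probability (BSub G) R) : Prop :=
  IRS lambda /\
  forall A : set (BSub G), measurable A ->
    (forall g : G, (conj_sub g : BSub G -> BSub G) @^-1` A = A) ->
    lambda A = 0 \/ lambda A = 1.

End IRS.

(* Measures of the library are functions on all sets, hence this relation
   rather than [=]. *)
Definition same_measure d (T : measurableType d) (R : realType)
    (m1 m2 : set T -> \bar R) : Prop :=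
  forall A, measurable A -> m1 A = m2 A.

Section Stabilizers.
Variable k : branching.

Lemma stab_closed r (x : r.-tuple (seqspace k)) :
  group_closed (fun g : SDS k => `[< forall i, act g (tnth x i) = tnth x i >]).
Proof.
split=> [|g h]; rewrite !unfold_in /=.
  by apply/asboolP => i; exact: act1.
move=> /asboolP gx /asboolP hx; apply/asboolP => i.
by rewrite actM gx -[in LHS](hx i) -actM mulgV act1.
Qed.

Definition stab_sub r (x : r.-tuple (seqspace k)) : Sub (SDS k) :=
  mk_sub (stab_closed x).

Lemma stretch_even n (s : {perm level k n}) :
  s \in 'Alt_(level k n) -> stretch s \in 'Alt_(level k n.+1).
Proof.
rewrite !Alt_even; pose f (u : {perm level k n}) := odd_perm (stretch u).
have fM u v : f (u * v) = f u (+) f v by rewrite /f gmulfM odd_permM.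
have fJ u v : f (u ^ v) = f u.
  have := fM v (u ^ v); rewrite mulgA mulgV mul1g fM.
  by case: (f u); case: (f v); case: (f _).
have f3 x y z : x != y -> x != z -> f (tperm x y) = f (tperm x z).
  move=> xy xz; rewrite -(fJ (tperm x y) (tperm y z)) tpermJ tpermL.
  by have -> : tperm y z x = x by apply: tpermD; rewrite eq_sym.
have f4 x y z w : x != y -> z != w -> f (tperm x y) = f (tperm z w).
  move=> xy; have [<-|xz zw] := eqVneq x z; first exact: f3.
  by rewrite (f3 _ _ _ xy xz) tpermC; apply: f3 => //; rewrite eq_sym.
rewrite -/(f s); have [ts -> dts] := prod_tpermP s.
have [b fb] : exists b : bool, forall t : level k n * level k n, perm.dpair t ->
    f (tperm t.1 t.2) = b.
  have [[x y] xy|no] := pickP (@perm.dpair (level k n)).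
    by exists (f (tperm x y)) => -[z w] zw; exact: f4.
  by exists true => t; rewrite no.
rewrite odd_perm_prod//.
have -> : f (\prod_(t <- ts) tperm t.1 t.2) = odd (size ts) && b.
  elim: ts dts => [_|t ts IH /= /andP[dt dts]].
    rewrite big_nil /f (_ : stretch 1 = 1) ?odd_perm1//.
    exact: (@phi1 (fun n => {perm level k n} : groupType)
      (fun n => @stretch k n) n).
  by rewrite big_cons fM fb// IH//; case: b {fb IH}; case: (odd _).
by case: (odd _).
Qed.

(* [A(G)] as a predicate: the elements represented by an even permutation of
   some [level n]. *)
Definition alt_mem (g : SDS k) : bool :=
  `[< exists n (s : {perm level k n}),
      s \in 'Alt_(level k n) /\ g = dl_in _ s >].

Lemma alt_mem_le g : alt_mem g -> exists n, forall m, (n <= m)%N ->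
  exists2 s : {perm level k m}, s \in 'Alt_(level k m) & g = dl_in _ s.
Proof.
move=> /asboolP[n [s [As ->]]]; exists n => m /subnK <-.
elim: (m - n)%N => [|p [t At ->]]; first by exists s.
by exists (stretch t : {perm level k (p + n).+1});
  [exact: stretch_even|rewrite (dl_in_phi _ t)].
Qed.

Lemma alt_closed : group_closed alt_mem.
Proof.
split=> [|g h].
  by apply/asboolP; exists 0%N, 1; rewrite group1.
move=> /alt_mem_le[n gn] /alt_mem_le[m hm].
have [s As ->] := gn (n + m)%N (leq_addr _ _).
have [t At ->] := hm (n + m)%N (leq_addl _ _).
apply/asboolP; exists (n + m)%N, (s * t^-1); split; first by rewrite groupM ?groupV.
by rewrite gmulfM; congr (_ * _); rewrite -[LHS]/(dl_inv _) -dl_inV.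
Qed.

Definition alt_sub : Sub (SDS k) := mk_sub alt_closed.

End Stabilizers.

Section ProductMeasure.
Local Open Scope ring_scope.
Variable k : branching.

Definition coord_sets : set (set (seqspace k)) :=
  [set A | exists n (B : set 'I_(k n)), A = [set x | B (x n)]].

(* [seqspace k] with the product of the discrete sigma-algebras. *)
Definition mseqspace := g_sigma_algebraType coord_sets.
HB.instance Definition _ := Measurable.on mseqspace.

Variable R : realType.

Definition uniform_mass n (B : set 'I_(k n)) : R :=
  #|[pred j | j \in B]|%:R / (k n)%:R.

Definition is_product_measure (m : probability mseqspace R) : Prop :=
  forall N (B : forall n, set 'I_(k n)),
    m [set x | forall n, (n < N)%N -> B n (x n)]
      = (\prod_(n < N) uniform_mass (B n))%:E.

(* Existence: expansion of a uniform real of [0, 1[ in the mixed radix [k]. *)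

Let P N := (\prod_(i < N) k i)%N.
Let trunc N (u : R) : nat := Num.truncn (u * (P N)%:R).
Let digits (u : measurableTypeR R) : mseqspace :=
  fun n => Ordinal (ltn_pmod (trunc n.+1 u) (br_gt0 k n)).

Let P_gt0 N : (0 < P N)%N.
Proof. by apply: prodn_gt0 => i; exact: br_gt0. Qed.

Let PS N : P N.+1 = (P N * k N)%N. Proof. by rewrite /P big_ord_recr. Qed.

Let truncS N u : 0 <= u -> trunc N u = (trunc N.+1 u %/ k N)%N.
Proof.
move=> u0; have kN := br_gt0 k N; have kN' : 0 < (k N)%:R :> R by rewrite ltr0n.
have /andP[q1 q2] : (trunc N.+1 u)%:R <= u * (P N.+1)%:R < (trunc N.+1 u).+1%:R.
  by rewrite truncn_itv// mulr_ge0.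
rewrite PS natrM mulrA in q1 q2; apply/eqP; rewrite truncn_eq ?mulr_ge0//.
apply/andP; split.
- rewrite -(ler_pM2r kN') (le_trans _ q1)// -natrM ler_nat.
  exact: leq_divM.
- by rewrite -(ltr_pM2r kN') (lt_le_trans q2)// -natrM ler_nat ltn_ceil.
Qed.

Let measurable_digits : measurable_fun [set: measurableTypeR R] digits.
Proof.
apply: measurability => [//|_ [_ [n [B ->]] <-]].
rewrite setTI /=.
rewrite [X in measurable X](_ : _ = \bigcup_q
  if `[< B (Ordinal (ltn_pmod q (br_gt0 k n))) >]
  then [set u | trunc n.+1 u = q] else set0); last first.
  apply/seteqP; split=> u /=.
    by move=> Bu; exists (trunc n.+1 u) => //; case: asboolP.
  by move=> [q _]; case: asboolP => // Bq /= e; subst q.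
apply: bigcupT_measurable => q; case: ifP => // _.
have P0 : 0 < (P n.+1)%:R :> R by rewrite ltr0n.
rewrite [X in measurable X](_ : _ = `]-oo, (q.+1%:R / (P n.+1)%:R)[%classic `\`
    (if (0 < q)%N then `]-oo, (q%:R / (P n.+1)%:R)[%classic else set0)).
  by apply: measurableD => //; case: ifP.
apply/seteqP; split=> [u /= uq|u [/=]].
  have uq' : (trunc n.+1 u <= q)%N by rewrite uq.
  rewrite truncn_le_nat in uq'; split.
    by rewrite /= in_itv/= ltr_pdivlMr.
  case: ifP => [q0|_ []//]; rewrite /= in_itv/= ltr_pdivlMr// => uq1.
  have : (trunc n.+1 u <= q.-1)%N by rewrite truncn_le_nat prednK.
  by rewrite uq -ltnS prednK// ltnn.
rewrite in_itv/= ltr_pdivlMr// -truncn_le_nat => uq nuq.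
apply/eqP; rewrite eqn_leq uq/= leqNgt; apply/negP => uq1; apply: nuq.
have q0 := leq_ltn_trans (leq0n _) uq1.
by rewrite q0/= in_itv/= ltr_pdivlMr// -[q]prednK// -truncn_le_nat -ltnS prednK.
Qed.

Local Notation unit_meas := (mrestr (@lebesgue_measure R)
  (measurable_itv (`[0%R, 1%R[ : interval R))).

Let unit_measT : unit_meas [set: R] = 1%E.
Proof. by rewrite /mrestr setTI lebesgue_measure_itv/= lte01 sube0. Qed.

HB.instance Definition _ :=
  Measure_isProbability.Build _ _ _ unit_meas unit_measT.

Let unit_measE N (p : pred nat) :
  unit_meas [set u | p (trunc N u)] = ((\sum_(q < P N) (p q)%:R) / (P N)%:R)%:E.
Proof.
have PN : 0 < (P N)%:R :> R by rewrite ltr0n.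
pose I (q : 'I_(P N)) : set R := `[(q%:R / (P N)%:R), (q.+1%:R / (P N)%:R)[%classic.
have IP q u : I q u <-> 0 <= u /\ trunc N u = q.
  rewrite /I /= in_itv/= ler_pdivrMr// ltr_pdivlMr//; split=> [uq|[u0 /eqP]].
    have u0 : 0 <= u by rewrite -(pmulr_lge0 _ PN); case/andP: uq => /(le_trans _)->.
    by split=> //; apply/eqP; rewrite truncn_eq// mulr_ge0.
  by rewrite truncn_eq// mulr_ge0.
rewrite /mrestr.
rewrite [X in lebesgue_measure X](_ : _ = \big[setU/set0]_(q < P N | p q) I q); last first.
  rewrite -bigcup_seq_cond; apply/seteqP; split=> u /=.
    rewrite in_itv/= => -[pu /andP[u0 u1]].
    have uP : (trunc N u < P N)%N.
      by rewrite truncn_lt_nat ?mulr_ge0// -[ltRHS]mul1r ltr_pM2r.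
    exists (Ordinal uP); first by rewrite /= mem_index_enum.
    by apply/IP.
  move=> [q /andP[_ pq] /IP[u0 uq]]; rewrite uq in_itv/= u0; split=> //=.
  have : (trunc N u < P N)%N by rewrite uq.
  by rewrite truncn_lt_nat ?mulr_ge0// -[ltRHS]mul1r ltr_pM2r.
rewrite measure_bigsetU_ord_cond; last 2 first.
- by move=> q _; exact: measurable_itv.
- by move=> q q' _ _ [u [/IP[_ uq] /IP[_ uq']]]; apply/val_inj; exact: etrans (esym uq) uq'.
rewrite big_mkcond/= mulr_suml -sumEFin; apply: eq_bigr => q _.
case: (p q); last by rewrite mul0r.
rewrite lebesgue_measure_itv/= lte_fin ltr_pM2r ?invr_gt0// ltr_nat ltnSn.
by rewrite -EFinB -mulrBl -natrB// subSnn.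
Qed.

Lemma product_measure_exists : exists m, is_product_measure m.
Proof.
pose D : {mfun measurableTypeR R >-> mseqspace} := mfun_Sub (mem_set measurable_digits).
exists (distribution unit_meas D : probability _ _) => N B.
rewrite /= /distribution /pushforward.
pose good := fix good N (q : nat) : bool := if N is M.+1 then
  good M (q %/ k M)%N && (Ordinal (ltn_pmod q (br_gt0 k M)) \in B M) else true.
have goodE u : 0 <= u ->
    (forall n, (n < N)%N -> B n (digits u n)) <-> good N (trunc N u).
  move=> u0; elim: N => //= N IH; rewrite -truncS//; split.
    move=> Bu; apply/andP; split; last by rewrite inE; apply: (Bu N).
    by apply/IH => n /leqW; exact: Bu.
  move=> /andP[/IH Bu BN] n; rewrite ltnS leq_eqVlt => /predU1P[->|]; last exact: Bu.
  by rewrite inE in BN.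
transitivity (unit_meas [set u | good N (trunc N u)]).
  rewrite /mrestr; congr (lebesgue_measure _).
  apply/seteqP; split=> u [Bu /[dup] u01];
    rewrite /= in_itv/= => /andP[u0 _]; split=> //=; exact/(goodE u u0).
rewrite unit_measE; congr (_%:E).
elim: N {goodE} => [|N IH].
  by rewrite big_ord0 /P big_ord0 big_ord_recl big_ord0 addr0 divr1.
rewrite [RHS]big_ord_recr/= -IH /uniform_mass PS natrM.
rewrite mulrACA invfM; congr (_ * _).
rewrite -(big_mkord xpredT (fun q => (good N.+1 q)%:R)) big_nat_mul.
rewrite big_mkord mulr_suml; apply: eq_bigr => a _.
rewrite mulSnr -{1}[(a * k N)%N]add0n big_addn addKn big_mkord /=.
rewrite -sum1_card natr_sum mulr_sumr [RHS]big_mkcond/=; apply: eq_bigr => j _.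
have -> : ((j + a * k N) %/ k N = a)%N.
  by rewrite addnC divnMDl ?br_gt0// divn_small ?addn0.
rewrite (_ : Ordinal _ = j); last by apply/val_inj; rewrite /= addnC modnMDl modn_small.
rewrite (_ : (j \in [pred j | j \in B N]) = (j \in B N))// mulr1.
by case: (j \in B N); rewrite ?andbT ?andbF.
Qed.

Definition product_mu : probability mseqspace R :=
  projT1 (cid product_measure_exists).

Lemma product_muP : is_product_measure product_mu.
Proof. exact: projT2 (cid _). Qed.

End ProductMeasure.

Section PowerMeasure.
Context d (T : measurableType d) (R : realType) (P : probability T R).
Local Open Scope ereal_scope.

Definition is_power_measure r (Q : probability (r.-tuple T) R) : Prop :=
  forall A : 'I_r -> set T, (forall i, measurable (A i)) ->
    Q [set t | forall i, A i (tnth t i)] = \prod_(i < r) P (A i).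

Let measurable_box r (A : 'I_r -> set T) : (forall i, measurable (A i)) ->
  measurable [set t : r.-tuple T | forall i, A i (tnth t i)].
Proof.
move=> mA; rewrite [X in measurable X](_ : _ =
    \bigcap_(i in [set: 'I_r]) ((fun t => tnth t i) @^-1` A i)); last first.
  by apply/seteqP; split=> t /= tA i => [_|]; exact: tA.
apply: fin_bigcap_measurable => // i _.
rewrite -[X in measurable X]setTI.
exact: (@measurable_tnth _ T r i).
Qed.

Lemma power_measure_exists r : exists Q, @is_power_measure r Q.
Proof.
elim: r => [|r [Q QP]].
  exists (dirac [tuple]) => A mA; rewrite big_ord0 /= diracE mem_set//.
  by move=> -[].
have mc : measurable_fun [set: T * r.-tuple T]
    (fun z => [the r.+1.-tuple T of z.1 :: z.2]) by exact: measurable_cons.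
pose c : {mfun (T * r.-tuple T)%type >-> r.+1.-tuple T} :=
  mfun_Sub (mem_set mc).
exists (distribution (P \x Q)%E c : probability _ _) => A mA.
transitivity ((P \x Q) (A ord0 `*`
    [set t | forall i, A (lift ord0 i) (tnth t i)])).
  rewrite /= /distribution /pushforward; congr (product_measure1 _ _ _).
  apply/seteqP; split=> -[x t] /=.
    move=> xt; split=> [|i]; first exact: (xt ord0).
    by have := xt (lift ord0 i); rewrite /= tnthS.
  move=> [x0 xt] i; have [j ->|->] := unliftP ord0 i; last exact: x0.
  by rewrite /= tnthS; exact: xt.
rewrite product_measure1E//; last first.
  by apply: (@measurable_box r (fun i => A (lift ord0 i))) => i; exact: mA.
rewrite big_ord_recl; congr (_ * _).
exact: (QP (fun i => A (lift ord0 i)) (fun i => mA _)).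
Qed.

Definition power_measure r : probability (r.-tuple T) R :=
  projT1 (cid (power_measure_exists r)).

Lemma power_measureP r : is_power_measure (power_measure r).
Proof. exact: projT2 (cid _). Qed.

End PowerMeasure.

Section StabilizerDistributions.
Variables (R : realType) (k : branching) (r : nat).

Definition sigma : set (BSub (SDS k)) -> \bar R :=
  pushforward (power_measure (product_mu k R) r)
    (fun x : r.-tuple (mseqspace k) => stab_sub x : BSub (SDS k)).

Definition sigma_alt : set (BSub (SDS k)) -> \bar R :=
  pushforward (power_measure (product_mu k R) r)
    (fun x : r.-tuple (mseqspace k) =>
       cap_sub (stab_sub x) (alt_sub k) : BSub (SDS k)).

End StabilizerDistributions.
Arguments sigma : clear implicits.
Arguments sigma_alt : clear implicits.

(* Main.v *)
(** Write H for a random subgroup with the law of an ergodic IRS other than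
    delta_1. Some g <> 1 of some G_n lies in H with positive probability c. At a
    high level there are at least 2/c conjugates of g such that quotients of two
    of them are three-cycles, and by pigeonhole two of them lie in H together with
    probability bounded below; so every three-cycle of every high level lies in H
    with probability at least some d > 0.

    The three-cycles of H in G_m link the points of X_m by an equivalence
    relation, and H contains all even permutations of each class. With probability
    bounded below the class of a given point has at least (d/2) |X_m| elements. If
    it also had many points in its complement, exchanging a point of the class with
    a point outside it would, by conjugation invariance, contradict the presence
    in H of a fixed g <> 1. Hence with positive probability, and by ergodicity
    almost surely, H contains Alt(X_n \ D_n) for some D_n whose size is bounded
    independently of n. Let r be the least such bound. The r points of the minimal
    D_n are exchangeable, so at high levels their tails are different, and
    then H fixes D_n pointwise. So the trace of H on G_n is the pointwise stabilizer
    of r points or its even part. When k_(n+1) is even, even permutations of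
    X_(n+1) already induce all permutations of X_n, so the even part is ruled out;
    otherwise the event that H lies in A(G) is invariant, so of probability 0 or 1.

    Thus the trace of H on G_n lies in a single conjugacy class with probability
    tending to 1, as does the trace under sigma_r, under its even variant, or, for
    r = 0, under a Dirac measure. Two invariant finite measures of the same mass
    that concentrate on the same classes agree. Applied to the restriction of such
    an IRS to an invariant event, this also gives ergodicity. *)
Require Import Defs.
From HB Require Import structures.
From mathcomp Require Import all_boot all_order all_algebra all_fingroup.
From mathcomp Require Import all_solvable.
From mathcomp Require Import zify lra.

Set Implicit Arguments.
Unset Strict Implicit.
Unset Printing Implicit Defensive.

Import Order.TTheory GRing.Theory Num.Theory.

Local Open Scope group_scope.

Ltac neqs := repeat match goal with
  | |- context [?x == ?x] => rewrite (eqxx x)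
  | H : is_true (~~ (?x == ?y)) |- context [?x == ?y] => rewrite (negbTE H)
  | H : is_true (~~ (?x == ?y)) |- context [?y == ?x] =>
      rewrite (eq_sym y x) (negbTE H)
  end.

(** * Three-cycles in a permutation group *)

Lemma perm_neq1 (T : finType) (s : {perm T}) : s != 1 -> exists x, s x != x.
Proof.
move=> s1; apply/existsP; apply: contraNT s1; rewrite negb_exists => /forallP s1.
by apply/eqP/permP => x; rewrite perm1; apply/eqP; move: (s1 x); rewrite negbK.
Qed.

Section ThreeCycles.
Variable T : finType.
Implicit Types (a b c d e x y z : T) (s : {perm T}) (K : {group {perm T}})
  (D : {set T}).

(** Products compose from left to right, so on distinct points this is the cycle sending [a] to [b],
    [b] to [c] and [c] to [a]. *)
Definition c3 a b c : {perm T} := tperm a b * tperm a c.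

Lemma c3J a b c s : c3 a b c ^ s = c3 (s a) (s b) (s c).
Proof. by rewrite conjMg !tpermJ. Qed.

Lemma c3E a b c x : b != a -> c != a -> c != b ->
  c3 a b c x =
  if x == a then b else if x == b then c else if x == c then a else x.
Proof.
move=> ba ca cb; rewrite permM.
have [->|xa] := eqVneq x a; first by rewrite tpermL tpermD // eq_sym.
have [->|xb] := eqVneq x b; first by rewrite tpermR tpermL.
rewrite (tpermD (x := a) (y := b)) 1?eq_sym //.
have [->|xc] := eqVneq x c; first by rewrite tpermR.
by rewrite tpermD // eq_sym.
Qed.

Lemma c3_rot a b c : b != a -> c != a -> c != b -> c3 b c a = c3 a b c.
Proof.
move=> ba ca cb; have := c3J a b c (c3 a b c).
rewrite conjgE mulKg !c3E // eqxx (negbTE ba) eqxx (negbTE ca) (negbTE cb).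
by rewrite eqxx.
Qed.

Lemma c3V a b c : (c3 a b c)^-1 = c3 a c b.
Proof. by rewrite invMg !tpermV. Qed.

Definition link (K : {set {perm T}}) a b :=
  (a == b) || [exists c, [&& c != a, c != b & c3 a b c \in K]].

Lemma linkP (K : {set {perm T}}) a b :
  reflect (a = b \/ exists c, [/\ b != a, c != a, c != b & c3 a b c \in K])
    (link K a b).
Proof.
rewrite /link; have [->|ab] := eqVneq a b; first by constructor; left.
apply: (iffP existsP) => [[c /and3P[ca cb Kc]]|].
  by right; exists c.
by case=> [/eqP|[c [_ ca cb Kc]]]; [rewrite (negbTE ab)|exists c; apply/and3P].
Qed.

Lemma link_refl (K : {set {perm T}}) a : link K a a.
Proof. by rewrite /link eqxx. Qed.

Lemma link_sym K a b : link K a b -> link K b a.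
Proof.
case/linkP=> [->|[c [ba ca cb Kc]]]; first exact: link_refl.
apply/linkP; right; exists c; split=> //; first by rewrite eq_sym.
by rewrite -groupV c3V c3_rot.
Qed.

(** Conjugating [c3 a b c] by [c3 b d e], which fixes [a] and sends [b] to [d], gives a cycle
    through [a] and [d]. In the coincidences [c = d] and [e = a] one of the two given cycles already
    passes through both points. *)
Lemma link_trans K a b d : link K a b -> link K b d -> link K a d.
Proof.
case/linkP=> [-> //|[c [ba ca cb Kp]]].
case/linkP=> [<-|[e [db eb ed Kq]]]; first by apply/linkP; right; exists c.
have [->|ad] := eqVneq a d; first exact: link_refl.
apply/linkP; right; have [cd|cd] := eqVneq c d.
  exists b; rewrite 1?[b == d]eq_sym [d == a]eq_sym; split=> //.
  by rewrite -cd -groupV c3V.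
have [ea|ea] := eqVneq e a.
  exists b; rewrite 1?[b == d]eq_sym [d == a]eq_sym; split=> //.
  by subst e; rewrite -groupV c3V -c3_rot // eq_sym.
have Kpq : c3 a b c ^ c3 b d e \in K by rewrite groupJ.
have q : [/\ c3 b d e a = a, c3 b d e b = d & c3 b d e c != a /\ c3 b d e c != d].
  rewrite !c3E // eqxx (negbTE ad) eq_sym (negbTE ba) eq_sym (negbTE ea).
  rewrite (negbTE cb) (negbTE cd); split=> //.
  by case: ifP => _; split=> //; rewrite eq_sym.
case: q => qa qb [qca qcd]; exists (c3 b d e c); split=> //.
  by rewrite eq_sym.
by rewrite c3J qa qb in Kpq.
Qed.

Lemma c3_share K b c d e : c != b -> d != b -> e != b -> d != c -> e != c ->
  e != d -> c3 b c e \in K -> c3 b d e \in K -> c3 b c d \in K.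
Proof.
move=> cb db eb dc ec ed Kp Kq.
have := groupJ Kp Kq; rewrite c3J !c3E //; neqs => Kr.
by rewrite -groupV c3V -c3_rot; neqs.
Qed.

(** While [link] asks for some third point, any third point of the class serves. If the witnesses
    [e] and [f] differ, conjugating the first cycle by the second gives [c3 d c e]; then [c], [b]
    and [c], [d] share the third point [e]. *)
Lemma link_c3 K b c d : c != b -> d != b -> d != c ->
  link K b c -> link K b d -> c3 b c d \in K.
Proof.
move=> cb db dc /linkP[/eqP|[e [_ eb ec Kp]]]; first by rewrite eq_sym (negbTE cb).
case/linkP=> [/eqP|[f [_ fb fd Kq]]]; first by rewrite eq_sym (negbTE db).
have [ed|ed] := eqVneq e d; first by rewrite -ed.
have [fc|fc] := eqVneq f c; first by rewrite -groupV c3V; rewrite fc in Kq.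
have [ef|ef] := eqVneq e f; first by apply: (@c3_share _ b c d e); rewrite // ef.
have Kr : c3 d c e \in K by have := groupJ Kp Kq; rewrite c3J !c3E //; neqs.
rewrite -c3_rot; neqs => //; rewrite -groupV c3V.
apply: (@c3_share _ c b d e); neqs => //.
  by rewrite -groupV c3V c3_rot; neqs.
by rewrite -groupV c3V c3_rot; neqs.
Qed.

Definition altfix D : {group {perm T}} := 'C(D | 'P) :&: 'Alt_T.

Definition core (K : {set {perm T}}) D := altfix D \subset K.

Lemma fixP D s : reflect (forall x, x \in D -> s x = x) (s \in 'C(D | 'P)).
Proof. by apply: (iffP astabP) => fs x /fs; rewrite /= apermE. Qed.

Lemma altfixP D s :
  reflect ((forall x, x \in D -> s x = x) /\ s \in 'Alt_T) (s \in altfix D).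
Proof.
apply: (iffP setIP) => -[fs As]; split=> //; first exact/fixP.
exact/fixP.
Qed.

Lemma c3_even a b c : b != a -> c != a -> c3 a b c \in 'Alt_T.
Proof. by move=> ba ca; rewrite Alt_even odd_permM !odd_tperm eq_sym ba eq_sym ca. Qed.

Lemma c3_altfix a b c D : b != a -> c != a -> c != b ->
  a \notin D -> b \notin D -> c \notin D -> c3 a b c \in altfix D.
Proof.
move=> ba ca cb aD bD cD; apply/altfixP; split; last exact: c3_even.
move=> x xD; rewrite c3E //; case: eqVneq => [xa|_]; first by rewrite -xa xD in aD.
case: eqVneq => [xb|_]; first by rewrite -xb xD in bD.
by case: eqVneq => [xc|_] //; rewrite -xc xD in cD.
Qed.

(** Induction on the number of moved points. Multiplying [s] by [c3 (s x) x y], with [y] a third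
    moved point, fixes [x] and moves no new point. Without such a [y], [s] would be a transposition,
    hence odd. *)
Lemma core_c3 K D :
  (forall b c d, b \notin D -> c \notin D -> d \notin D ->
     c != b -> d != b -> d != c -> c3 b c d \in K) -> core K D.
Proof.
move=> KD; apply/subsetP => s.
have [n] := ubnP #|[set x | s x != x]|; elim: n s => // n IH s sn As.
have [fs As'] := altfixP _ _ As.
have [->|/perm_neq1[x sx]] := eqVneq s 1; first exact: group1.
have moved y : s y != y -> y \notin D by apply: contraNN => /fs->.
have ssx : s (s x) != s x by rewrite (inj_eq perm_inj).
have [/existsP[y /and3P[yx ysx sy]]|] :=
    boolP [exists y, [&& y != x, y != s x & s y != y]]; last first.
  rewrite negb_exists => /forallP st.
  suff s2 : s = tperm x (s x) by rewrite s2 Alt_even odd_tperm eq_sym sx in As'.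
  apply/permP => y; have [->|yx] := eqVneq y x; first by rewrite tpermL.
  have fy z : z != x -> z != s x -> s z = z.
    by move=> zx zsx; move: (st z); rewrite zx zsx negbK => /eqP.
  have [->|ysx] := eqVneq y (s x); last by rewrite fy // tpermD // eq_sym.
  rewrite tpermR; apply/eqP; apply: contraT => ssxx.
  by have := fy _ ssxx ssx => /perm_inj/perm_inj/eqP; rewrite (negbTE sx).
have K3 : c3 (s x) x y \in K.
  by apply: KD => //; rewrite 1?moved // eq_sym.
rewrite -(groupMr _ K3); apply: IH; last first.
  rewrite groupM // c3_altfix // ?moved // 1?eq_sym //.
rewrite ltnS in sn; apply: leq_trans sn.
rewrite [X in (_ < X)%N](cardsD1 x) inE sx add1n ltnS.
apply/subset_leq_card/subsetP => z; rewrite !inE permM.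
have [->|zx] := eqVneq z x; first by rewrite c3E ?eqxx // eq_sym.
apply: contraNN => /eqP sz; rewrite sz c3E ?(eq_sym _ y) //; last by rewrite eq_sym.
rewrite (negbTE zx); case: (eqVneq z (s x)) => [zsx|zsx].
  by rewrite -zsx sz zsx eqxx in ssx.
by case: (eqVneq z y) => [zy|//]; rewrite -zy sz eqxx in sy.
Qed.

Definition lclass (K : {set {perm T}}) a := [set b | link K a b].

Lemma core_lclass K a : core K (~: lclass K a).
Proof.
apply: core_c3 => b c d; rewrite !inE !negbK => ab ac ad cb db dc.
by apply: link_c3 => //; apply: link_trans (link_sym ab) _.
Qed.

Lemma core_link K D a b : core K D -> (3 <= #|~: D|)%N ->
  a \notin D -> b \notin D -> link K a b.
Proof.
move=> /subsetP KD D3 aD bD; have [->|ab] := eqVneq a b; first exact: link_refl.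
have : (0 < #|(~: D) :\ a :\ b|)%N.
  rewrite -(ltn_add2l 2) addn0 (leq_trans D3) //.
  by rewrite (cardsD1 a) (cardsD1 b (_ :\ _)) !inE eq_sym ab aD bD.
case/card_gt0P=> c; rewrite !inE => /and3P[cb ca cD].
apply/linkP; right; exists c; split=> //; first by rewrite eq_sym.
by apply: KD; rewrite c3_altfix // eq_sym.
Qed.

Lemma altfixS D D' : D \subset D' -> altfix D' \subset altfix D.
Proof.
move=> /subsetP DD'; apply/subsetP => s /altfixP[fs As]; apply/altfixP.
by split=> // x /DD'; apply: fs.
Qed.

(** The size bound leaves a point [a] outside both sets and three points in each complement. So both
    complements lie in the link class of [a], and [core_lclass] applies to their union. *)
Lemma core_setI K D D' : core K D -> core K D' ->
  (#|D| + #|D'| + 3 <= #|T|)%N -> core K (D :&: D').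
Proof.
move=> KD KD' DD'.
have c3D (A B : {set T}) : (#|A| + #|B| + 3 <= #|T|)%N -> (3 <= #|~: A|)%N.
  by move=> AB; rewrite -(leq_add2l #|A|) cardsC (leq_trans _ AB) // addnAC leq_addr.
have D3 := c3D _ _ DD'.
have D3' : (3 <= #|~: D'|)%N by apply: (c3D _ D); rewrite (addnC #|D'|).
have : (0 < #|~: (D :|: D')|)%N.
  rewrite -(ltn_add2l #|D :|: D'|) addn0 cardsC (leq_trans _ DD') //.
  by rewrite addnS ltnS (leq_trans (leq_card_setU _ _)) // leq_addr.
case/card_gt0P=> a; rewrite !inE negb_or => /andP[aD aD'].
apply: subset_trans (core_lclass K a); apply: altfixS.
rewrite -setCS setCK setCI; apply/subsetP => b.
rewrite !inE => /orP[] bD; exact: core_link aD bD || exact: core_link aD' bD.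
Qed.

Lemma mem_conj_perm (K : {set {perm T}}) s u : (s ^ u \in K :^ u) = (s \in K).
Proof. exact: memJ_conjg. Qed.

Lemma linkJ (K : {set {perm T}}) a b u : link (K :^ u) (u a) (u b) = link K a b.
Proof.
rewrite /link (inj_eq perm_inj); congr (_ || _).
apply/existsP/existsP => -[c /and3P[ca cb Kc]].
  move: ca cb Kc; rewrite -{1 2 3}(permKV u c) !(inj_eq perm_inj) => ca cb Kc.
  by exists ((u^-1)%g c); rewrite ca cb -(mem_conj_perm _ _ u) c3J.
by exists (u c); rewrite !(inj_eq perm_inj) ca cb -c3J mem_conj_perm.
Qed.

Lemma fixJ D (u : {perm T}) : 'C(u @: D | 'P) = 'C(D | 'P) :^ u.
Proof.
apply/setP => s; rewrite mem_conjg; apply/fixP/fixP => fs x xD.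
  by rewrite conjgE invgK !permM fs ?permK // imset_f.
case/imsetP: xD => y yD ->; have := fs _ yD.
by rewrite conjgE invgK !permM => /(canRL (permKV u)) ->.
Qed.

Lemma AltJ u : 'Alt_T :^ u = 'Alt_T.
Proof. by apply/setP=> s; rewrite mem_conjg !Alt_even odd_permJ. Qed.

Lemma altfixJ D (u : {perm T}) : altfix (u @: D) = altfix D :^ u :> {set _}.
Proof. by rewrite /= conjIg -fixJ AltJ. Qed.

Lemma coreJ (K : {set {perm T}}) D (u : {perm T}) : core (K :^ u) (u @: D) = core K D.
Proof. by rewrite /core altfixJ conjSg. Qed.

End ThreeCycles.

Local Open Scope ring_scope.

(** * Counting pairs, and transitivity of symmetric groups *)

Lemma card_offdiag (I : finType) (A : {set I}) :
  #|[set ij : I * I | [&& ij.1 \in A, ij.2 \in A & ij.1 != ij.2]]|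
    = (#|A| * #|A|.-1)%N.
Proof.
rewrite -sum1_card (eq_bigl (fun ij : I * I => (ij.1 \in A) && (ij.2 \in A :\ ij.1))).
  rewrite -(pair_big_dep (mem A) (fun i j => j \in A :\ i) (fun _ _ => 1%N)) /=.
  rewrite (eq_bigr (fun _ => #|A|.-1)) ?sum_nat_const // => i iA.
  by rewrite sum1_card (cardsD1 i A) iA.
by move=> [i j]; rewrite !inE /= eq_sym [(j \in A) && _]andbC.
Qed.

Lemma card_fibers (I J : finType) (A : {set I}) (B : I -> {set J}) m :
  (forall i, i \in A -> (m <= #|B i|)%N) ->
  (#|A| * m <= #|[set ij : I * J | (ij.1 \in A) && (ij.2 \in B ij.1)]|)%N.
Proof.
move=> mB; rewrite -[X in (_ <= X)%N]sum1_card.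
rewrite (eq_bigl (fun ij : I * J => (ij.1 \in A) && (ij.2 \in B ij.1))).
  rewrite -(pair_big_dep (mem A) (fun i j => j \in B i) (fun _ _ => 1%N)) /=.
  rewrite -sum_nat_const; apply: leq_sum => i iA.
  by rewrite sum1_card mB.
by move=> [i j]; rewrite !inE.
Qed.

Lemma leq_predD1 (I : finType) (A : {set I}) a : (#|A|.-1 <= #|A :\ a|)%N.
Proof. by rewrite (cardsD1 a A); case: (a \in A) => //=; exact: leq_pred. Qed.

Section Transitivity.
Variable T : finType.

Lemma perm2_trans (a b a' b' : T) : b != a -> b' != a' ->
  exists s : {perm T}, s a = a' /\ s b = b'.
Proof.
move=> ba ba'; exists (tperm a a' * tperm (tperm a a' b) b')%g.
rewrite !permM !tpermL; split=> //; rewrite tpermD // 1?eq_sym //.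
by rewrite eq_sym -{2}(tpermL a a') (inj_eq perm_inj).
Qed.

Lemma perm3_trans (a b c a' b' c' : T) : b != a -> c != a -> c != b ->
  b' != a' -> c' != a' -> c' != b' ->
  exists s : {perm T}, [/\ s a = a', s b = b' & s c = c'].
Proof.
move=> ba ca cb ba' ca' cb'; have [s [sa sb]] := perm2_trans ba ba'.
exists (s * tperm (s c) c')%g; rewrite !permM sa sb tpermL.
by split=> //; rewrite tpermD // -1?sa -1?sb 1?(inj_eq perm_inj).
Qed.

(** Induction on the size of [A :\: B]: a transposition exchanges a point of [A :\: B] with one of
    [B :\: A]. *)
Lemma perm_set_trans (A B : {set T}) : #|A| = #|B| ->
  exists u : {perm T}, u @: A = B.
Proof.
have [n] := ubnP #|A :\: B|; elim: n A => // n IH A; rewrite ltnS => ABn AB.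
have [AB0|/set0Pn[a]] := eqVneq (A :\: B) set0.
  exists 1%g; rewrite (eq_imset (g := id)) ?imset_id => [|x]; last by rewrite perm1.
  by apply/eqP; rewrite eqEcard AB leqnn andbT -setD_eq0 AB0.
rewrite inE => /andP[aB aA].
have : (0 < #|B :\: A|)%N.
  rewrite -(ltn_add2l #|B :&: A|) addn0 cardsID -AB -(cardsID B A) setIC.
  by rewrite -[X in (X < _)%N]addn0 ltn_add2l; apply/card_gt0P; exists a; rewrite inE aB.
case/card_gt0P=> b; rewrite inE => /andP[bA bB].
have [||u uB] := IH (tperm a b @: A); last first.
- exists (tperm a b * u)%g; rewrite -uB -imset_comp; apply: eq_imset => x.
  by rewrite permM.
- by rewrite card_imset //; exact: perm_inj.
apply: leq_trans ABn; rewrite [X in (_ < X)%N](cardsD1 a) inE aB aA add1n ltnS.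
apply/subset_leq_card/subsetP => x; rewrite !inE => /andP[xB /imsetP[y yA xy]].
move: xB; rewrite xy; case: tpermP => [ya|yb|/eqP ya /eqP yb]; rewrite ?bB //.
  by rewrite -yb yA in bA.
by move=> yB; rewrite yB yA ya.
Qed.

End Transitivity.

(** * Random subgroups of a finite symmetric group *)

Section Weights.
Variables (R : realFieldType) (T : finType).
Implicit Types (p : {set {perm T}} -> R) (Q : pred {set {perm T}}).

Definition Pr p Q : R := \sum_(K | Q K) p K.

(** The law of a random subgroup, as a mass function on sets of permutations carried by the
    subgroups. The total mass is left free, so that the restriction of a law to an invariant event
    also qualifies. *)
Definition weight p := [/\ forall K, 0 <= p K, forall K, p K != 0 -> group_set K
  & forall (K : {set {perm T}}) u, p (K :^ u)%g = p K].

Section Basic.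
Variables (p : {set {perm T}} -> R) (pw : weight p).

Lemma Pr_ge0 Q : 0 <= Pr p Q.
Proof. by case: pw => p0 _ _; apply: sumr_ge0. Qed.

Lemma eq_Pr Q Q' : Q =1 Q' -> Pr p Q = Pr p Q'.
Proof. by move=> QQ'; apply: eq_bigl. Qed.

Lemma Pr_sub Q Q' : (forall K : {group {perm T}}, Q K -> Q' K) -> Pr p Q <= Pr p Q'.
Proof.
case: pw => p0 pg _ QQ'; rewrite /Pr big_mkcond [leRHS]big_mkcond /=.
apply: ler_sum => K _; have [->|/pg gK] := eqVneq (p K) 0; first by rewrite !if_same.
by have := QQ' (group gK); case: (Q K); case: (Q' K) => // /(_ isT).
Qed.

Lemma Pr_or Q Q1 Q2 : (forall K : {group {perm T}}, Q K -> Q1 K || Q2 K) ->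
  Pr p Q <= Pr p Q1 + Pr p Q2.
Proof.
case: pw => p0 pg _ QQ'; rewrite /Pr ![X in _ <= X + _]big_mkcond.
rewrite ![X in _ <= _ + X]big_mkcond.
rewrite [leLHS]big_mkcond -big_split /=.
apply: ler_sum => K _; have [->|/pg gK] := eqVneq (p K) 0; first by rewrite !if_same addr0.
have := p0 K; have := QQ' (group gK) => /=.
by case: (Q K); case: (Q1 K); case: (Q2 K) => //= /[swap] ? h; try (by have := h isT); lra.
Qed.

Lemma PrJ Q u : Pr p (fun K => Q (K :^ u)%g) = Pr p Q.
Proof.
case: pw => _ _ pJ; rewrite /Pr [RHS](reindex_inj (can_inj (conjsgK u))) /=.
by apply: eq_bigr => K _; rewrite pJ.
Qed.

Lemma Pr_sum (I : finType) (P : pred I) (S : I -> pred {set {perm T}}) :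
  \sum_(i | P i) Pr p (S i) = \sum_K p K * #|[set i | P i && S i K]|%:R.
Proof.
rewrite /Pr (exchange_big_dep xpredT) //=; apply: eq_bigr => K _.
rewrite mulr_natr sumr_const; congr (_ *+ _).
by apply: eq_card => i; rewrite inE.
Qed.

Lemma Pr_count_ge (I : finType) Q (S : I -> pred {set {perm T}}) s :
  (forall K : {group {perm T}}, Q K -> (s <= #|[set i | S i K]|)%N) ->
  s%:R * Pr p Q <= \sum_i Pr p (fun K => Q K && S i K).
Proof.
case: pw => p0 pg _ sQ; rewrite (Pr_sum xpredT) /Pr big_mkcond mulr_sumr /=.
apply: ler_sum => K _; have [->|/pg gK] := eqVneq (p K) 0.
  by rewrite if_same mulr0 mul0r.
have := sQ (group gK) => /=; case: (Q K) => [/(_ isT) sK|_]; last first.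
  by rewrite mulr0 mulr_ge0.
by rewrite mulrC ler_wpM2l // ler_nat.
Qed.

Lemma Pr_count_le (I : finType) (P : pred I) (S : I -> pred {set {perm T}}) w :
  (forall K : {group {perm T}}, (#|[set i | P i && S i K]| <= w)%N) ->
  \sum_(i | P i) Pr p (S i) <= w%:R * Pr p xpredT.
Proof.
case: pw => p0 pg _ wS; rewrite Pr_sum /Pr mulr_sumr.
apply: ler_sum => K _; have [->|/pg gK] := eqVneq (p K) 0.
  by rewrite mulr0 mul0r.
by rewrite mulrC ler_wpM2r // ler_nat; exact: (wS (group gK)).
Qed.

Lemma Pr_union (I : finType) (P : pred I) Q (S : I -> pred {set {perm T}}) :
  (forall K : {group {perm T}}, Q K -> exists2 i, P i & S i K) ->
  Pr p Q <= \sum_(i | P i) Pr p (S i).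
Proof.
move=> QS; rewrite -[leLHS]mul1r.
apply: le_trans (Pr_count_ge (s := 1) (S := fun i K => P i && S i K) _) _.
  by move=> K /QS[i Pi Si]; apply/card_gt0P; exists i; rewrite inE Pi.
rewrite [leRHS]big_mkcond; apply: ler_sum => i _; case: (P i).
  by apply: Pr_sub => K /andP[].
by rewrite /Pr big1 // => K; rewrite andbF.
Qed.

(* Conjugation by [tperm x z] preserves probabilities, and sends [Q] and
   [S x z] into [W x]; so a small [W] makes [Q] unlikely when [S] is large. *)
Lemma Pr_swap Q (S : T -> T -> pred {set {perm T}}) (W : T -> pred {set {perm T}})
    s w :
  (forall (K : {group {perm T}}) x z, Q K -> S x z K -> W x (K :^ tperm x z)%g) ->
  (forall K : {group {perm T}}, Q K -> (s <= #|[set xz | S xz.1 xz.2 K]|)%N) ->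
  (forall K : {group {perm T}}, (#|[set x | W x K]| <= w)%N) ->
  s%:R * Pr p Q <= w%:R * #|T|%:R * Pr p xpredT.
Proof.
move=> SW sS wW.
apply: le_trans (Pr_count_ge (S := fun xz : T * T => S xz.1 xz.2) sS) _.
apply: (@le_trans _ _ (\sum_(xz : T * T) Pr p (W xz.1))).
  apply: ler_sum => -[x z] _ /=; rewrite -(PrJ (W x) (tperm x z)).
  by apply: Pr_sub => K /andP[]; exact: SW.
rewrite -(pair_big xpredT xpredT (fun x _ => Pr p (W x))) /=.
under eq_bigr => x _ do rewrite sumr_const -mulr_natl.
rewrite -mulr_sumr mulrAC mulrC ler_wpM2r //.
exact: (Pr_count_le (P := xpredT)).
Qed.

Hypothesis p1 : Pr p xpredT = 1.

Lemma Pr_le1 Q : Pr p Q <= 1.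
Proof. by rewrite -p1; apply: Pr_sub. Qed.

Lemma Pr_true Q : (forall K : {group {perm T}}, Q K) -> Pr p Q = 1.
Proof. by move=> QT; apply/le_anti; rewrite Pr_le1 -{1}p1; apply: Pr_sub. Qed.

(** If [Z] counts the [h i] in [K], its mean is [M * c], at least 2. Since
    [Z * (Z - 1) >= 2 * Z - 2], the mean number of ordered pairs of distinct indices with both
    elements in [K] is at least 2 as well. *)
Lemma pigeonhole M (h : 'I_M -> {perm T}) (c : R) :
  (forall i, Pr p (fun K => h i \in K) = c) -> 2 <= M%:R * c ->
  2 <= \sum_(ij : 'I_M * 'I_M | ij.1 != ij.2)
        Pr p (fun K => (h ij.1 * (h ij.2)^-1)%g \in K).
Proof.
case: (pw) => p0 pg _ hc Mc.
pose Z (K : {set {perm T}}) := #|[set i | h i \in K]|.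
have Zc : \sum_K p K * (Z K)%:R = M%:R * c.
  rewrite /Z -(Pr_sum xpredT (fun i (K : {set {perm T}}) => h i \in K)).
  under eq_bigr do rewrite hc.
  by rewrite sumr_const card_ord mulr_natl.
apply: (@le_trans _ _ (\sum_(ij : 'I_M * 'I_M | ij.1 != ij.2)
    Pr p (fun K : {set {perm T}} => (h ij.1 \in K) && (h ij.2 \in K)))); last first.
  apply: ler_sum => -[i j] _; apply: Pr_sub => K /andP[Ki Kj].
  by rewrite groupM // groupV.
rewrite Pr_sum; apply: (@le_trans _ _ (\sum_K p K * ((Z K)%:R *+ 2 - 2))).
  rewrite (eq_bigr (fun K => (p K * (Z K)%:R) *+ 2 - p K * 2)); last first.
    by move=> K _; lra.
  by rewrite sumrB sumrMnl Zc -mulr_suml -/(Pr p xpredT) p1; lra.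
apply: ler_sum => K _; rewrite ler_wpM2l //.
rewrite (_ : #|_| = (Z K * (Z K).-1)%N); last first.
  rewrite -card_offdiag; apply: eq_card => -[i j]; rewrite !inE /=.
  by case: (i == j); rewrite ?andbF ?andbT //= andbT.
rewrite lerBlDr -mulrnA -natrD ler_nat.
by case: (Z K) => [|[|z]] //=; rewrite !mulnS; nia.
Qed.

End Basic.
End Weights.

(** * Cores of least size *)

Section MinimalCore.
Variable T : finType.
Implicit Types (K : {set {perm T}}) (D : {set T}).

Definition mincore r K D :=
  [&& core K D, #|D| == r & [forall D', core K D' ==> (r <= #|D'|)%N]].

Lemma mincoreP r K D : reflect [/\ core K D, #|D| = r &
  forall D', core K D' -> (r <= #|D'|)%N] (mincore r K D).
Proof.
apply: (iffP and3P) => [[KD /eqP Dr /forallP DK]|[KD Dr DK]]; split=> //.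
- by move=> D' KD'; have := DK D'; rewrite KD'.
- exact/eqP.
- by apply/forallP => D'; apply/implyP; exact: DK.
Qed.

(** By [core_setI] the intersection of the two is again a core, so minimality makes it equal to
    both. *)
Lemma mincore_uniq r (K : {group {perm T}}) D D' : (r + r + 3 <= #|T|)%N ->
  mincore r K D -> mincore r K D' -> D = D'.
Proof.
move=> rT /mincoreP[KD Dr DK] /mincoreP[KD' D'r _].
have KI : core K (D :&: D') by apply: core_setI => //; rewrite Dr D'r.
have rI := DK _ KI.
have /eqP <- : D :&: D' == D by rewrite eqEcard subsetIl Dr.
by apply/eqP; rewrite eqEcard subsetIr D'r.
Qed.

Lemma imset_permVK (u : {perm T}) D : u @: ((u^-1)%g @: D) = D.
Proof.
by rewrite -imset_comp (eq_imset (g := id)) ?imset_id // => x /=; rewrite permKV.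
Qed.

Lemma mincoreJ r K D (u : {perm T}) :
  mincore r (K :^ u) (u @: D) = mincore r K D.
Proof.
rewrite /mincore coreJ card_imset; last exact: perm_inj.
congr [&& _, _ & _]; apply/forallP/forallP => DK D'.
  by have := DK (u @: D'); rewrite coreJ card_imset //; exact: perm_inj.
have := DK ((u^-1)%g @: D'); rewrite card_imset; last exact: perm_inj.
by rewrite -(coreJ K _ u) imset_permVK.
Qed.

Lemma mincore_stab r (K : {group {perm T}}) D s : (r + r + 3 <= #|T|)%N ->
  mincore r K D -> s \in K -> s @: D = D.
Proof.
move=> rT KD Ks; apply: (mincore_uniq (K := K) rT) => //.
by rewrite -[X in mincore r X](conjGid Ks) mincoreJ.
Qed.

Definition has_core l (K : {set {perm T}}) :=
  [exists D : {set T}, core K D && (#|D| <= l)%N].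

Lemma has_coreJ l (K : {set {perm T}}) u : has_core l (K :^ u)%g = has_core l K.
Proof.
apply/existsP/existsP => -[D /andP[KD Dl]].
  exists ((u^-1)%g @: D); rewrite -(coreJ _ _ u) imset_permVK KD.
  by rewrite card_imset //; exact: perm_inj.
by exists (u @: D); rewrite coreJ KD card_imset //; exact: perm_inj.
Qed.

Definition at_core r (K : {set {perm T}}) :=
  [exists D : {set T}, mincore r K D].

(** Such a [K] lies between [altfix D] and the full pointwise stabilizer of [D], so
    [core_even_or_full] leaves two possibilities. *)
Definition at_fixed r (K : {set {perm T}}) :=
  [exists D : {set T}, [&& #|D| == r, core K D & K \subset 'C(D | 'P)]].

Lemma core_even_or_full (K : {group {perm T}}) D :
  core K D -> K \subset 'C(D | 'P) ->
  if K \subset 'Alt_T then K :=: 'C(D | 'P) :&: 'Alt_T else K :=: 'C(D | 'P).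
Proof.
move=> KD KC; case: ifPn => [KA|/subsetPn[s Ks sA]].
  apply/eqP; rewrite eqEsubset subsetI KC KA; exact: KD.
apply/eqP; rewrite eqEsubset KC; apply/subsetP => t tC.
have [tA|tA] := boolP (t \in 'Alt_T).
  by apply: (subsetP KD); rewrite inE tC.
rewrite -(groupMr t Ks); apply: (subsetP KD); apply/altfixP; split.
  by apply/fixP; apply: groupM => //; exact: (subsetP KC).
by move: sA tA; rewrite !Alt_even odd_permM !negbK => -> ->.
Qed.

End MinimalCore.

(** * Probability estimates for an invariant random subgroup *)

Section RandomSubgroup.
Variables (R : realFieldType) (T : finType) (p : {set {perm T}} -> R).
Hypotheses (pw : weight p) (p1 : Pr p xpredT = 1).
Implicit Types (K : {set {perm T}}).

Lemma Pr_memJ g u : Pr p (fun K => (g ^ u)%g \in K) = Pr p (fun K => g \in K).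
Proof.
by rewrite -(PrJ pw _ u); apply: eq_Pr => K; rewrite mem_conj_perm.
Qed.

Lemma Pr_c3 a b c a' b' c' : b != a -> c != a -> c != b ->
  b' != a' -> c' != a' -> c' != b' ->
  Pr p (fun K => c3 a b c \in K) = Pr p (fun K => c3 a' b' c' \in K).
Proof.
move=> ba ca cb ba' ca' cb'.
have [s [<- <- <-]] := perm3_trans ba ca cb ba' ca' cb'.
by rewrite -c3J Pr_memJ.
Qed.

(* [g ^ tperm x z] is [g ^ tperm x y] conjugated by [tperm y z], so the quotient
   is a product of two transpositions that share the point [z]. *)
Lemma swap_c3 (g : {perm T}) (x y z : T) : g x != x -> g y = y -> g z = z -> y != z ->
  exists a, [/\ a != z, y != z, y != a &
    ((g ^ tperm x y) * (g ^ tperm x z)^-1)%g = c3 z a y].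
Proof.
move=> gx gy gz yz; have xy : x != y by apply: contraNneq gx => ->; rewrite gy.
have xz : x != z by apply: contraNneq gx => ->; rewrite gz.
set h := (g ^ tperm x y)%g.
have hz : h z = z by rewrite /h conjgE !permM tpermV (tpermD xz yz) gz (tpermD xz yz).
have hy : h y != y.
  rewrite /h conjgE !permM tpermV tpermR; apply: contra_neq gx => e.
  by apply: (@perm_inj _ (tperm x y)); rewrite e tpermL.
have hE : (g ^ tperm x z = h ^ tperm y z)%g.
  rewrite /h -conjgM; have -> : (tperm x y * tperm y z = tperm y z * tperm x z)%g.
    by rewrite conjgC tpermJ tpermL (@tpermD _ y z x) // eq_sym.
  rewrite conjgM; congr (_ ^ _)%g.
  apply/permP => w; rewrite conjgE !permM tpermV.
  have [->|wy] := eqVneq w y; first by rewrite tpermL gz tpermR gy.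
  have [->|wz] := eqVneq w z; first by rewrite tpermR gy tpermL gz.
  rewrite (@tpermD _ y z w) ?tpermD //; rewrite 1?eq_sym //.
    by rewrite -[X in _ != X]gy (inj_eq perm_inj).
  by rewrite -[X in _ != X]gz (inj_eq perm_inj).
exists ((h^-1)%g y); split=> //.
- by apply: contra_neq yz => e; rewrite -(permKV h y) e hz.
- by apply: contra_neq hy => e; rewrite {1}e permKV.
have tJ : (tperm y z ^ h^-1 = tperm ((h^-1)%g y) z)%g.
  by rewrite tpermJ -[X in tperm _ ((h^-1)%g X)]hz permK.
rewrite hE /c3 [tperm z _]tpermC -tJ [tperm z y]tpermC.
by clearbody h; rewrite !conjgE !invMg !invgK !tpermV !mulgA.
Qed.

(** The conjugates of [g] by the transpositions of [x] and [y i] have quotients that are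
    three-cycles by [swap_c3]. All three-cycles have the same probability, and the pigeonhole sum
    has at most [M ^ 2] terms. *)
Lemma c3_likely M (y : 'I_M -> T) (g : {perm T}) x c a b e : injective y -> g x != x ->
  (forall i, g (y i) = y i) -> Pr p (fun K => g \in K) = c -> 2 <= M%:R * c ->
  b != a -> e != a -> e != b ->
  2 <= M%:R ^+ 2 * Pr p (fun K => c3 a b e \in K).
Proof.
move=> yI gx gy gc Mc ba ea eb.
have hc i : Pr p (fun K => (g ^ tperm x (y i))%g \in K) = c by rewrite Pr_memJ.
apply: le_trans (pigeonhole pw p1 hc Mc) _.
apply: (@le_trans _ _ (\sum_(ij : 'I_M * 'I_M) Pr p (fun K => c3 a b e \in K))).
  rewrite [leLHS]big_mkcond; apply: ler_sum => -[i j] _ /=.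
  case: ifP => ij; last exact: Pr_ge0.
  have yij : y i != y j by rewrite (inj_eq yI).
  have [w [wj _ iw ->]] := swap_c3 gx (gy i) (gy j) yij.
  by rewrite (Pr_c3 (a' := a) (b' := b) (c' := e)).
by rewrite sumr_const card_prod card_ord -[leLHS]mulr_natl natrM expr2.
Qed.

Lemma conj_tperm_out (g : {perm T}) x y w : x != w -> y != w -> x != g w ->
  y != g w -> (g ^ tperm x y)%g w = g w.
Proof.
by move=> xw yw xgw ygw; rewrite conjgE !permM tpermV (tpermD xw yw) tpermD.
Qed.

(** This prepares [c3_likely], which asks for fixed points that [g] may lack. A quotient of two
    conjugates of [g] by transpositions through [x] moves only few points, and by pigeonhole some
    such quotient has positive probability. *)
Lemma fixing_conjugate M (g : {perm T}) c : g != 1%g -> Pr p (fun K => g \in K) = c ->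
  2 <= M%:R * c -> (M + 7 <= #|T|)%N ->
  exists h : {perm T}, [/\ h != 1%g, exists x, h x = x & 0 < Pr p (fun K => h \in K)].
Proof.
move=> g1 gc Mc MT.
have [x gx] := perm_neq1 g1.
(* The [y i] are taken outside these at most three points, so that neither [y i] nor [g (y i)] is
   [x], and [y i] is not [g x]. *)
pose A := [set x; g x; (g^-1)%g x].
have MA : (M <= #|~: A|)%N.
  rewrite -(leq_add2l #|A|) cardsC (leq_trans _ MT) // addnC leq_add2l //.
  by rewrite /A -setUA !cardsU1 cards1; do 2!case: (_ \notin _).
pose y (i : 'I_M) := enum_val (widen_ord MA i).
have yI : injective y by move=> i j /enum_val_inj e; apply: val_inj; exact: (congr1 val e).
have yA i : [/\ y i != x, y i != g x & g (y i) != x].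
  have := enum_valP (widen_ord MA i).
  rewrite !inE -/(y i) !negb_or => /andP[/andP[-> ->]] H.
  by split=> //; apply: contra_neq H => <-; rewrite permK.
have hc i : Pr p (fun K => (g ^ tperm x (y i))%g \in K) = c by rewrite Pr_memJ.
have S2 := pigeonhole pw p1 hc Mc.
have /existsP[[i j] /andP[/= ij hij]] : [exists ij : 'I_M * 'I_M,
   (ij.1 != ij.2) && (0 < Pr p (fun K => (g ^ tperm x (y ij.1) *
     (g ^ tperm x (y ij.2))^-1)%g \in K))].
  apply: contraLR (lt_le_trans (ltr0Sn R 1) S2) => /existsPn S0.
  rewrite -leNgt; apply: sumr_le0 => ij nij.
  by have := S0 ij; rewrite nij /= -leNgt.
have [yix yigx gyix] := yA i; have [yjx yjgx gyjx] := yA j.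
exists (g ^ tperm x (y i) * (g ^ tperm x (y j))^-1)%g; split=> //.
  apply: contraNneq ij => /eqP; rewrite -eq_mulgV1 => /eqP e.
  (* At [y i] the first conjugate takes the value [g x], and the second one takes another value
     unless [i = j]. *)
  have := congr1 (fun s : {perm T} => s (y i)) e; rewrite !conjgE !permM !tpermV tpermR.
  rewrite (tpermD (x := x) (y := y i)) 1?eq_sym // -1?eq_sym //.
  have [eij|nij] := eqVneq (y i) (y j); first by move=> _; apply/eqP/yI.
  have [xyi ji xgx] : [/\ x != y i, y j != y i & x != g x].
    by rewrite eq_sym yix eq_sym nij eq_sym gx.
  rewrite (tpermD xyi ji).
  move/(congr1 (tperm x (y j))); rewrite tpermK tpermD // => /perm_inj e'.
  by rewrite -e' eqxx in yix.
(* For [w] outside [B], both [w] and [g w] avoid [x], [y i] and [y j], so both conjugates send [w]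
   to [g w]. *)
pose B := [set:: [:: x; y i; y j; (g^-1)%g x; (g^-1)%g (y i); (g^-1)%g (y j)]].
have /card_gt0P[w] : (0 < #|~: B|)%N.
  rewrite -(ltn_add2l #|B|) addn0 cardsC (leq_trans _ MT) // addnS ltnS.
  by rewrite cardsE (leq_trans (card_size _)) // leq_addl.
rewrite !inE !negb_or => /andP[wx /andP[wi /andP[wj /andP[wx' /andP[wi' wj']]]]].
have gw z : w != (g^-1)%g z -> z != g w.
  by apply: contra_neq => ->; rewrite permK.
exists w; rewrite permM conj_tperm_out 1?eq_sym // 1?eq_sym ?gw //.
apply: (@perm_inj _ (g ^ tperm x (y j))%g); rewrite permKV.
by rewrite conj_tperm_out 1?eq_sym // 1?eq_sym ?gw.
Qed.

(** Each point is linked to [a] with probability at least [d], so the class has mean size at least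
    [d * #|T|]. As its size never exceeds [#|T|], it reaches half of that mean bound with
    probability at least [d / 2]. *)
Lemma lclass_large (d : R) a : 0 <= d <= 1 -> (3 <= #|T|)%N ->
  (forall b c e : T, c != b -> e != b -> e != c -> d <= Pr p (fun K => c3 b c e \in K)) ->
  d / 2 <= Pr p (fun K => d / 2 * #|T|%:R <= #|lclass K a|%:R).
Proof.
move=> /andP[d0 d1] T3 dc3; case: (pw) => p0 _ _.
have T0 : 0 < #|T|%:R :> R by rewrite ltr0n (leq_trans _ T3).
have lk b : d <= Pr p (fun K => link K a b).
  have [<-|ab] := eqVneq a b.
    by rewrite (Pr_true pw p1) // => K; exact: link_refl.
  have : (0 < #|~: [set a; b]|)%N.
    by rewrite -(ltn_add2l #|[set a; b]|) addn0 cardsC cards2 ab.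
  case/card_gt0P=> e; rewrite !inE negb_or => /andP[ea eb].
  apply: (le_trans (dc3 a b e _ ea eb)); first by rewrite eq_sym.
  apply: Pr_sub => // K Ke; apply/linkP; right; exists e; split=> //.
  by rewrite eq_sym.
have ND : \sum_(b : T) d <= \sum_(b : T) Pr p (fun K => link K a b) by apply: ler_sum.
rewrite sumr_const -[leLHS]mulr_natl (Pr_sum p xpredT) in ND.
have : #|T|%:R * d <= \sum_K (p K * #|T|%:R *
    ((d / 2 * #|T|%:R <= #|lclass K a|%:R)%R : nat)%:R
    + p K * (d / 2 * #|T|%:R)).
  apply: le_trans ND _; apply: ler_sum => K _; rewrite -mulrA -mulrDr ler_wpM2l //.
  rewrite (_ : #|_| = #|lclass K a|); last by apply: eq_card => b; rewrite !inE.
  have [big|/ltW small] := leP (d / 2 * #|T|%:R) #|lclass K a|%:R; last first.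
    by rewrite mulr0 add0r.
  rewrite mulr1 (@le_trans _ _ #|T|%:R) ?ler_nat ?max_card // lerDl.
  by rewrite mulr_ge0 // divr_ge0.
rewrite big_split /= -mulr_suml -/(Pr p xpredT) p1 mul1r.
have -> : \sum_K p K * #|T|%:R * ((d / 2 * #|T|%:R <= #|lclass K a|%:R)%R : nat)%:R =
   #|T|%:R * Pr p (fun K => d / 2 * #|T|%:R <= #|lclass K a|%:R).
  rewrite /Pr mulr_sumr [RHS]big_mkcond; apply: eq_bigr => K _.
  by case: ifP => _; [rewrite mulr1 mulrC | rewrite mulr0].
move=> H; rewrite -(ler_pM2l T0); lra.
Qed.

Lemma link_perm (G : {group {perm T}}) g a b : g \in G ->
  link G (g a) (g b) = link G a b.
Proof. by move=> Gg; rewrite -[RHS](linkJ _ _ _ g) conjGid. Qed.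

Lemma link_sym_eq (G : {group {perm T}}) a b : link G a b = link G b a.
Proof. by apply/idP/idP; exact: link_sym. Qed.

Lemma link_eql (G : {group {perm T}}) a b c : link G a b -> link G a c = link G b c.
Proof.
move=> ab; apply/idP/idP; first exact: link_trans (link_sym ab).
exact: link_trans ab.
Qed.

Lemma link_tperm (K : {set {perm T}}) a x z w : x != a -> z != a ->
  link (K :^ tperm x z) a w = link K a (tperm x z w).
Proof.
by move=> xa za; rewrite -(linkJ K _ _ (tperm x z)) tpermK tpermD.
Qed.

(* Swap a moved point [x] with a point [z] on the other side of the class of [a]:
   in the conjugate of [K] only [x], [z] and their preimages under [g] leave
   their side. *)
Lemma invariant_class_unlikely (g : {perm T}) a m :
  ((#|[set x | g x != x]|.-1 * m.-1)%N%:R *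
    Pr p (fun K => [&& g \in K, link K a (g a), (m <= #|lclass K a|)%N &
                       (m <= #|~: lclass K a|)%N]) <= 4 * #|T|%:R).
Proof.
set Q := (X in Pr p X).
pose S x z K := [&& x != a, z != a, g x != x & link K a x != link K a z].
pose V K := [set w | link K a w != link K a (g w)].
pose W x K := (x \in V K) && (#|V K| <= 4)%N.
rewrite -[leRHS]mulr1 -[X in _ <= _ * X]p1; apply: (Pr_swap pw (S := S) (W := W)).
- move=> K x z /and4P[Kg aga _ _] /and4P[xa za gx cxz].
  have cg w : link K a (g w) = link K a w.
    by rewrite (link_eql _ aga) link_perm.
  have c' w := link_tperm K w xa za.
  have cgxz : link K a (g x) != link K a z by rewrite cg.
  have xgx : x != g x by rewrite eq_sym.
  have zgx : z != g x by apply: contraNneq cgxz => <-.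
  apply/andP; split; first by rewrite inE !c' tpermL (tpermD xgx zgx) cg eq_sym.
  have VS : V (K :^ tperm x z)%g \subset [set:: [:: x; z; (g^-1)%g x; (g^-1)%g z]].
    apply/subsetP => w; rewrite !inE !c'; apply: contraR.
    rewrite !negb_or => /and4P[wx wz wgx wgz].
    have out v : w != (g^-1)%g v -> v != g w.
      by apply: contra_neq => ->; rewrite permK.
    by rewrite (@tpermD _ x z w) 1?eq_sym // tpermD ?cg ?eqxx ?out.
  by apply: leq_trans (subset_leq_card VS) _; rewrite cardsE card_size.
- move=> K /and4P[_ _ m1 m2].
  pose B x := [set z | link K a x != link K a z] :\ a.
  apply: (@leq_trans (#|[set x | g x != x] :\ a| * m.-1)).
    by rewrite leq_mul2r leq_predD1 orbT.
  apply: leq_trans (card_fibers (B := B) _) _.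
    move=> x _; rewrite /B.
    have mB : (m <= #|[set z | link K a x != link K a z]|)%N.
      case: (link K a x).
        rewrite (_ : [set _ | _] = ~: lclass K a) //.
        by apply/setP => z; rewrite !inE; case: link.
      rewrite (_ : [set _ | _] = lclass K a) //.
      by apply/setP => z; rewrite !inE; case: link.
    by apply: leq_trans (leq_predD1 _ a); rewrite -!subn1 leq_sub2r.
  apply/subset_leq_card/subsetP => -[x z].
  rewrite !inE /= => /and3P[/andP[xa gx] za cxz].
  exact/and4P.
- move=> K; rewrite /W; case: (leqP #|V K| 4) => V4.
    by rewrite (_ : [set x | _] = V K) //; apply/setP => x; rewrite !inE andbT.
  by rewrite (_ : [set x | _] = set0) ?cards0 //; apply/setP => x; rewrite !inE andbF.
Qed.

(* Swap a preimage [x] of a point of the class of [a] with a point [z] of the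
   class: in the conjugate of [K], only [x] and its preimage under [g] can lie in
   the class together with their images under [g]. *)
Lemma moving_class_unlikely (g : {perm T}) a m :
  ((m * m.-2)%N%:R *
    Pr p (fun K => [&& g \in K, ~~ link K a (g a) & (m <= #|lclass K a|)%N])
     <= 2 * #|T|%:R).
Proof.
set Q := (X in Pr p X).
pose S x z K := [&& ~~ link K a x, link K a (g x), link K a z, z != a & z != g x].
pose V K := [set w | link K a w && link K a (g w)].
pose W x K := (x \in V K) && (#|V K| <= 2)%N.
rewrite -[leRHS]mulr1 -[X in _ <= _ * X]p1; apply: (Pr_swap pw (S := S) (W := W)).
- move=> K x z /and3P[Kg aga _] /and5P[cx cgx cz za zgx].
  have cg w : link K a w -> link K a (g w) = false.
    move=> aw; apply: contraNF aga => agw; apply: link_trans agw _.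
    by rewrite link_perm // link_sym_eq.
  have xa : x != a by apply: contraNneq cx => ->; exact: link_refl.
  have c' w := link_tperm K w xa za.
  have gx : x != g x by apply: contraNneq cx => ->.
  have xV : link K a (tperm x z x) && link K a (tperm x z (g x)).
    by rewrite tpermL cz tpermD.
  apply/andP; split; first by rewrite inE !c'.
  have VS : V (K :^ tperm x z)%g \subset [set:: [:: x; (g^-1)%g x]].
    apply/subsetP => w; rewrite !inE !c'; apply: contraTT.
    rewrite negb_or => /andP[wx wgx]; have xgw : g w != x.
      by apply: contra_neq wgx => <-; rewrite permK.
    have out v : v != x -> link K a (tperm x z v) -> link K a v.
      by move=> vx; case: tpermP => // [/eqP|_]; rewrite ?(negbTE vx) // (negbTE cx).
    apply/negP => /andP[/(out _ wx)/cg] + /(out _ xgw).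
    by move=> ->.
  by apply: leq_trans (subset_leq_card VS) _; rewrite cardsE card_size.
- move=> K /and3P[Kg aga mK].
  have cg w : link K a w -> link K a (g w) = false.
    move=> aw; apply: contraNF aga => agw; apply: link_trans agw _.
    by rewrite link_perm // link_sym_eq.
  pose B x := lclass K a :\ a :\ g x.
  apply: (@leq_trans (#|g @^-1: lclass K a| * m.-2)).
    rewrite leq_mul2r; apply/orP; right; rewrite card_preimset //; exact: perm_inj.
  apply: leq_trans (card_fibers (B := B) _) _.
    move=> x _; apply: leq_trans (leq_predD1 _ _); rewrite -!subn1 leq_sub2r //.
    by apply: leq_trans (leq_predD1 _ _); rewrite -!subn1 leq_sub2r.
  apply/subset_leq_card/subsetP => -[x z]; rewrite !inE /= => /and4P[cgx zgx za cz].
  apply/and5P; split=> //; apply: contraTN cgx => /cg->//.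
- move=> K; rewrite /W; case: (leqP #|V K| 2) => V2.
    by rewrite (_ : [set x | _] = V K) //; apply/setP => x; rewrite !inE andbT.
  by rewrite (_ : [set x | _] = set0) ?cards0 //; apply/setP => x; rewrite !inE andbF.
Qed.

(** By double transitivity every pair of distinct points lies in the minimal core with the same
    probability [e]. The minimal core is unique, so [#|T| * (#|T| - 1) * e] is at most [r * r],
    while at most [#|T| * q] pairs have equal tails. *)
Lemma tail_coincidence (Y : finType) (tl : T -> Y) q r :
  (forall y, #|[set x | tl x == y]| <= q)%N -> (r + r + 3 <= #|T|)%N ->
  #|T|.-1%:R * Pr p (fun K => [exists D, mincore r K D &&
     [exists u, exists v, [&& u \in D, v \in D, u != v & tl u == tl v]]])
  <= (q * (r * r))%N%:R.
Proof.
move=> qtl rT; set V := (X in Pr p X).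
pose E u v K := [exists D, [&& mincore r K D, u \in D & v \in D]].
have EJ u v u' v' : v != u -> v' != u' -> Pr p (E u v) = Pr p (E u' v').
  move=> vu vu'; have [s [<- <-]] := perm2_trans vu vu'.
  rewrite -(PrJ pw (E (s u) _) s); apply: eq_Pr => K; rewrite /E.
  apply/existsP/existsP => -[D /and3P[KD uD vD]].
    by exists (s @: D); rewrite mincoreJ KD !imset_f.
  exists ((s^-1)%g @: D); rewrite -(mincoreJ _ _ _ s) imset_permVK KD.
  by rewrite -(permK s u) -(permK s v) !imset_f.
have /card_gt1P[u0 [v0 [_ _ uv0]]] : (1 < #|[set: T]|)%N.
  by rewrite cardsT (leq_trans _ rT) // addnS ltnS addnS.
rewrite eq_sym in uv0; set e := Pr p (E u0 v0).
have e0 : 0 <= e := Pr_ge0 pw _.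
have H1 : (#|T| * #|T|.-1)%N%:R * e <= (r * r)%N%:R.
  rewrite -[#|T|]cardsT -card_offdiag -[leRHS]mulr1 -[X in _ <= _ * X]p1.
  apply: le_trans (Pr_count_le pw (P := fun ij : T * T => ij.2 != ij.1)
    (S := fun ij => E ij.1 ij.2) _).
    rewrite (eq_bigr (fun _ => e)); last by move=> [u v] uv; apply: EJ.
    rewrite sumr_const mulr_natl (_ : #|_| = #|[pred ij : T * T | ij.2 != ij.1]|) //.
    by apply: eq_card => -[u v]; rewrite !inE /= eq_sym.
  move=> K; have [/existsP[D KD]|] := boolP [exists D, mincore r K D].
    have /mincoreP[_ Dr _] := KD; rewrite -Dr -cardsX.
    apply/subset_leq_card/subsetP => -[u v].
    rewrite !inE => /andP[_ /existsP[D' /and3P[KD' uD vD]]].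
    by rewrite (mincore_uniq rT KD KD') uD.
  rewrite negb_exists => /forallP nK; rewrite (_ : [set _ | _] = set0) ?cards0 //.
  apply/setP => -[u v]; rewrite !inE; apply/negP => /andP[_ /existsP[D /andP[KD _]]].
  by have := nK D; rewrite KD.
have H2 : Pr p V <= (#|T| * q)%N%:R * e.
  apply: (@le_trans _ _ (\sum_(ij : T * T | (ij.2 != ij.1) && (tl ij.1 == tl ij.2)) e)).
    rewrite (eq_bigr (fun ij => Pr p (E ij.1 ij.2))) => [|[u v] /andP[vu _]]; last exact: EJ.
    apply: (Pr_union pw) => K.
    move=> /existsP[D /andP[KD /existsP[u /existsP[v /and4P[uD vD uv tuv]]]]].
    exists (u, v); first by rewrite /= eq_sym uv.
    by apply/existsP; exists D; rewrite KD uD.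
  rewrite sumr_const -[leLHS]mulr_natl ler_wpM2r // ler_nat.
  pose C := [pred ij : T * T | (ij.1 \in T) && (ij.2 \in [set x | tl x == tl ij.1])].
  apply: (@leq_trans #|C|).
    apply/subset_leq_card/subsetP => -[u v]; rewrite !inE /=.
    by case/andP=> _; rewrite eq_sym.
  rewrite -sum1_card -(pair_big_dep (mem T) (fun i j => j \in [set x | tl x == tl i])
    (fun _ _ => 1%N)) /=.
  by rewrite -sum_nat_const; apply: leq_sum => i _; rewrite sum1_card.
apply: le_trans (ler_wpM2l _ H2) _ => //.
rewrite mulrA -natrM (_ : (_ * _)%N = (q * (#|T| * #|T|.-1))%N); last first.
  by rewrite mulnC mulnAC mulnC mulnA.
by rewrite !(natrM _ q) -mulrA ler_wpM2l.
Qed.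

End RandomSubgroup.

(** * Comparison of two invariant weights *)

Section Uniqueness.
Variables (R : realFieldType) (T : finType) (p p' : {set {perm T}} -> R).
Hypotheses (pw : weight p) (pw' : weight p') (pp' : Pr p xpredT = Pr p' xpredT).

(** On the class of [K0] each weight is constant, so it is determined there by its mass on the
    class. The two masses agree up to [e], and what lies off the class adds at most another [e]. *)
Lemma Pr_close (K0 : {set {perm T}}) e Q :
  Pr p (fun K => K \notin K0 :^: [set: {perm T}]) <= e ->
  Pr p' (fun K => K \notin K0 :^: [set: {perm T}]) <= e ->
  Pr p Q <= Pr p' Q + (e + e).
Proof.
pose C := K0 :^: [set: {perm T}]; rewrite -/C => pe pe'.
have cE (p0 : {set {perm T}} -> R) : weight p0 -> forall Q,
    Pr p0 (fun K => (K \in C) && Q K) = p0 K0 * #|[set K in C | Q K]|%:R.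
  case=> _ _ pJ Q'; rewrite mulr_natr -sumr_const.
  rewrite [RHS](eq_bigl (fun K => (K \in C) && Q' K)); last by move=> K; rewrite !inE.
  by apply: eq_bigr => K /andP[/imsetP[u _ ->] _].
have CQ (p0 : {set {perm T}} -> R) : weight p0 ->
    Pr p0 xpredT <= Pr p0 (fun K => (K \in C) && true) + Pr p0 (fun K => K \notin C).
  by move=> w; apply: Pr_or => // K; case: (_ \in _).
have pQ : Pr p Q <= Pr p (fun K => (K \in C) && Q K) + e.
  apply: le_trans (lerD (lexx _) pe); apply: Pr_or => // K QK.
  by rewrite QK; case: (_ \in _).
have pQ' : Pr p' (fun K => (K \in C) && Q K) <= Pr p' Q.
  by apply: Pr_sub => // K /andP[].
have pC : Pr p (fun K => (K \in C) && true) <= Pr p' xpredT.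
  by rewrite -pp'; apply: Pr_sub.
have := CQ _ pw'; rewrite !(cE _ pw, cE _ pw') in pQ pQ' pC *.
have nn : #|[set K in C | Q K]|%:R <= #|[set K in C | true]|%:R :> R.
  by rewrite ler_nat; apply/subset_leq_card/subsetP => K; rewrite !inE => /andP[->].
set n := _%:R in pQ pQ' nn; set N := _%:R in pC nn * => pC'.
have n0 : 0 <= n by [].
have [le|/ltW le] := leP (p K0) (p' K0).
  have : p K0 * n <= p' K0 * n by rewrite ler_wpM2r.
  have := Pr_ge0 pw' (fun K => K \notin C); lra.
have : (p K0 - p' K0) * n <= (p K0 - p' K0) * N by rewrite ler_wpM2l // subr_ge0.
lra.
Qed.

End Uniqueness.

(** * Traces of a subgroup of the limit *)

From mathcomp Require Import all_classical all_reals all_analysis.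
Import Defs.

Local Open Scope group_scope.

(** The image of a transposition is a product of [k n.+1] disjoint transpositions, one for each
    value of the new coordinate. *)
Lemma odd_stretch (k : branching) n (s : {perm level k n}) :
  odd_perm (stretch s) = odd (k n.+1) && odd_perm s.
Proof.
have [ts -> dts] := prod_tpermP s.
rewrite odd_perm_prod //.
elim: ts dts => [_|t ts IH /= /andP[dt dts]].
  rewrite big_nil andbF (_ : stretch 1 = 1) ?odd_perm1 //.
  exact: (@phi1 (fun n => {perm level k n} : groupType) (fun n => @stretch k n) n).
rewrite big_cons stretchM odd_permM IH // -/(size ts).
rewrite (_ : odd_perm _ = odd (k n.+1)); first by case: (odd (k _)); case: (odd _).
pose us := [seq ((t.1, j), (t.2, j)) | j <- enum 'I_(k n.+1)].
rewrite (_ : stretch _ = \prod_(u <- us) tperm u.1 u.2).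
  have -> : odd (k n.+1) = odd (size us) by rewrite size_map -cardE card_ord.
  apply: odd_perm_prod.
  by apply/allP => _ /mapP[j _ ->]; rewrite /perm.dpair /= xpair_eqE eqxx andbT.
(* For the induction, the product runs over a list [l] of values; it acts only on the copies indexed
   by [l]. *)
have H (l : seq 'I_(k n.+1)) w i : uniq l ->
    (\prod_(u <- [seq ((t.1, j), (t.2, j)) | j <- l]) tperm u.1 u.2) (w, i)
    = (if i \in l then tperm t.1 t.2 w else w, i).
  elim: l w => [|j l IHl] w /=; first by rewrite big_nil perm1.
  case/andP=> jl ul; rewrite big_cons permM /= inE.
  have -> : tperm (t.1, j) (t.2, j) (w, i) = (if i == j then tperm t.1 t.2 w else w, i).
    have [->|ij] := eqVneq i j.
      have [->|wx] := eqVneq w t.1; first by rewrite !tpermL.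
      have [->|wy] := eqVneq w t.2; first by rewrite !tpermR.
      have ne a : w != a -> (a, j) != (w, j).
        by rewrite xpair_eqE eqxx andbT eq_sym.
      by rewrite !tpermD ?ne // eq_sym.
    by rewrite tpermD // xpair_eqE eq_sym (eq_sym j) (negbTE ij) andbF.
  rewrite IHl //; have [->|ij] //= := eqVneq i j; by rewrite (negbTE jl).
apply/permP => -[w i]; rewrite H ?enum_uniq // mem_enum permE /stretch_fun /=.
by [].
Qed.

Section Levels.
Variable k : branching.

Definition emb n (s : {perm level k n}) : SDS k := dl_in _ s.

Lemma embM n (s t : {perm level k n}) : emb (s * t) = emb s * emb t.
Proof. exact: gmulfM. Qed.

Lemma emb1 n : emb (1 : {perm level k n}) = 1.
Proof. exact: dl_in1. Qed.

Lemma embV n (s : {perm level k n}) : emb s^-1 = (emb s)^-1.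
Proof. exact: dl_inV. Qed.

Lemma embJ n (s t : {perm level k n}) : emb (s ^ t) = emb s ^ emb t.
Proof. by rewrite !conjgE !embM embV. Qed.

Lemma emb_stretch n (s : {perm level k n}) : emb (stretch s) = emb s.
Proof. exact: dl_in_phi. Qed.

Lemma act_emb n (s : {perm level k n}) x : act (emb s) x = act_level s x.
Proof. exact: act_in. Qed.

Lemma prefix_act n (s : {perm level k n}) x : prefix n (act_level s x) = s (prefix n x).
Proof. by rewrite /act_level prefix_graft. Qed.

Lemma act_fix n (s : {perm level k n}) x :
  act (emb s) x = x <-> s (prefix n x) = prefix n x.
Proof.
rewrite act_emb; split=> [e|e]; first by rewrite -prefix_act e.
apply: (@seqspace_ext k n) => [|m nm]; first by rewrite prefix_act.
by rewrite /act_level graft_out.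
Qed.

Lemma emb_inj n : injective (@emb n).
Proof.
move=> s t e; apply/permP => w.
by rewrite -(prefix_graft w point) -!prefix_act -!act_emb e.
Qed.

Lemma emb_surj (g : SDS k) :
  exists n, forall m, (n <= m)%N -> exists s : {perm level k m}, g = emb s.
Proof. exact: dl_in_le. Qed.

(** The higher level is a product of the lower one with a set [Y] of tails, on which the lower group
    acts trivially. Later arguments use this form for any [n <= m], without dependent indices. *)
Lemma level_split n m : (n <= m)%N ->
  exists (Y : finType) (f : level k m -> level k n * Y)
    (s : {perm level k n} -> {perm level k m}),
  [/\ bijective f, forall t w, f (s t w) = (t (f w).1, (f w).2),
      forall t, emb (s t) = emb t &
      forall t, t \in 'Alt_(level k n) -> s t \in 'Alt_(level k m)].
Proof.
move=> /subnK <-; elim: (m - n)%N => [|p [Y [f [s [bf fs es As]]]]].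
  exists unit, (fun w => (w, tt)), id; split=> //.
  by exists fst => // -[w []].
exists (Y * 'I_(k (p + n).+1))%type,
  (fun w : level k (p + n).+1 => ((f w.1).1, ((f w.1).2, w.2))),
  (fun t => stretch (s t) : {perm level k (p + n).+1}); split.
- case: bf => f' fK f'K.
  exists (fun w => (f' (w.1, w.2.1), w.2.2) : level k (p + n).+1) => [[w i]|[w [y i]]] /=.
    by rewrite -surjective_pairing fK.
  by rewrite f'K.
- by move=> t [w i]; rewrite permE /stretch_fun /= fs.
- by move=> t; rewrite emb_stretch es.
- by move=> t /As; exact: stretch_even.
Qed.

Lemma level_gt0 n : (0 < #|level k n|)%N.
Proof. by apply/card_gt0P; exists (prefix n point). Qed.

Lemma card_levelS n : #|level k n.+1| = (#|level k n| * k n.+1)%N.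
Proof. by rewrite card_prod card_ord. Qed.

Lemma card_level n : #|level k n| = (\prod_(i < n.+1) k i)%N.
Proof.
elim: n => [|n IH]; first by rewrite big_ord1 card_ord.
by rewrite card_levelS IH [RHS]big_ord_recr.
Qed.

Lemma ltn_level n : (n < #|level k n|)%N.
Proof.
elim: n => [|n IH]; first exact: level_gt0.
move: IH (br_ge2 k n.+1); rewrite card_levelS.
by move: #|level k n| (k n.+1) => a b; nia.
Qed.

Definition trace n (H : Sub (SDS k)) : {set {perm level k n}} :=
  [set s | emb s \in sub_mem H].

Lemma group_trace n H : group_set (trace n H).
Proof.
have [H1 HB] := sub_closed H; apply/group_setP; split=> [|s t].
  by rewrite inE emb1.
rewrite !inE => Hs Ht; have := HB _ _ Hs (HB _ _ H1 Ht).
by rewrite div1g invgK embM.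
Qed.

Lemma trace_conj n (u : {perm level k n}) H :
  trace n (conj_sub (emb u) H) = trace n H :^ u^-1.
Proof.
apply/setP => s; rewrite mem_conjgV !inE embJ.
by rewrite [LHS]unfold_in.
Qed.

Lemma Sub_ext (H H' : Sub (SDS k)) : (forall g, (g \in sub_mem H) = (g \in sub_mem H')) ->
  H = H'.
Proof. by move=> e; apply: val_inj; apply/funext => g; exact: e. Qed.

Lemma mem_trace_lift n m (s : {perm level k n}) (t : {perm level k m}) H :
  emb s = emb t -> (s \in trace n H) = (t \in trace m H).
Proof. by move=> e; rewrite !inE e. Qed.

Lemma trace_preim n m (s : {perm level k n} -> {perm level k m}) H :
  (forall t, emb (s t) = emb t) -> s @^-1: trace m H = trace n H.
Proof. by move=> es; apply/setP => t; rewrite !inE es. Qed.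

Lemma trace_stab r (x : r.-tuple (seqspace k)) n :
  trace n (stab_sub x) = 'C([set prefix n (tnth x i) | i : 'I_r] | 'P).
Proof.
apply/setP => s; rewrite inE [LHS]unfold_in.
apply/asboolP/fixP => [fs _ /imsetP[i _ ->]|fs i].
  exact/act_fix.
by apply/act_fix/fs; rewrite imset_f.
Qed.

Lemma trace_cap n H H' : trace n (cap_sub H H') = trace n H :&: trace n H'.
Proof. by apply/setP => s; rewrite !inE [LHS]unfold_in. Qed.

Lemma trace_whole n : trace n (whole_sub (SDS k)) = [set: {perm level k n}].
Proof. by apply/setP => s; rewrite !inE [LHS]unfold_in. Qed.

Lemma trace_triv n : trace n (triv_sub (SDS k)) = [set 1].
Proof.
apply/setP => s; rewrite !inE [LHS]unfold_in -(emb1 n).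
by rewrite (inj_eq (@emb_inj n)).
Qed.

(** An even permutation of the lower level that fixes the projection of [D] pointwise lifts to an
    even permutation fixing [D] pointwise. *)
Lemma core_proj n m H (D : {set level k m}) : (n <= m)%N -> core (trace m H) D ->
  exists D' : {set level k n}, core (trace n H) D' /\ (#|D'| <= #|D|)%N.
Proof.
move=> nm /fintype.subsetP mD; have [Y [f [s [bf fs es As]]]] := level_split nm.
exists ([set (f w).1 | w in D]); split; last exact: leq_imset_card.
apply/fintype.subsetP => t /altfixP[ft At]; rewrite (mem_trace_lift _ (esym (es t))).
apply: mD; apply/altfixP; split=> [w wD|]; last exact: As.
apply: (bij_inj bf); rewrite fs ft; last exact: imset_f.
by rewrite -surjective_pairing.
Qed.

(** Above level [n] all embeddings preserve parity, so an element that becomes even at some higher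
    level was even already. *)
Lemma trace_alt n : (forall m, (n < m)%N -> odd (k m)) -> 
  trace n (alt_sub k) = 'Alt_(level k n).
Proof.
move=> ko; apply/setP => s; rewrite inE [LHS]unfold_in.
apply/idP/idP => [/alt_mem_le[m Hm]|As]; last by apply/asboolP; exists n, s.
have [t At e] := Hm (n + m)%N (leq_addl _ _).
rewrite -/(emb s) -/(emb t) in e; rewrite Alt_even; rewrite Alt_even in At.
have [u [eu ou]] : exists u : {perm level k (m + n)}, emb u = emb s /\ odd_perm u = odd_perm s.
  elim: m {Hm t At e} => [|m [u [eu ou]]]; first by exists s.
  exists (stretch u : {perm level k (m + n).+1}); rewrite emb_stretch odd_stretch eu ou.
  by rewrite ko // ltnS leq_addl.
rewrite addnC in t At e *.
by rewrite -ou (emb_inj (etrans eu e)).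
Qed.

End Levels.

Local Open Scope classical_set_scope.
Local Open Scope group_scope.

(** * Cylinder events and the Borel sigma-algebra *)

Section Cylinders.
Variable k : branching.

Definition cyl n (Q : pred {set {perm level k n}}) : set (BSub (SDS k)) :=
  [set H | Q (trace n H)].

Definition cyls : set (set (BSub (SDS k))) := [set A | exists n Q, A = @cyl n Q].

Lemma cyl_lift n m (Q : pred {set {perm level k n}}) : (n <= m)%N ->
  exists Q', cyl Q = @cyl m Q'.
Proof.
move=> nm; have [Y [f [s [_ _ es _]]]] := level_split k nm.
exists (fun K : {set _} => Q (s @^-1: K)); apply/seteqP.
by split=> H; rewrite /cyl /= trace_preim.
Qed.

Lemma cyls_setI : setI_closed cyls.
Proof.
move=> _ _ [n [Q ->]] [m [Q' ->]].
have [S ->] := cyl_lift Q (leq_addr m n); have [S' ->] := cyl_lift Q' (leq_addl n m).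
by exists (n + m)%N, (fun K => S K && S' K); apply/seteqP; split=> H /andP.
Qed.

Lemma measurable_mem (g : SDS k) :
  measurable [set H : BSub (SDS k) | g \in sub_mem H].
Proof.
apply: sub_sigma_algebra.
exists ((fun h : {ptws SDS k -> bool} => h g) @^-1` [set true]) => //.
apply: open_comp => [h _|]; last exact: discrete_open.
exact: (@proj_continuous _ (fun _ => bool : topologicalType) g h).
Qed.

Lemma measurable_cyl n (Q : pred {set {perm level k n}}) : measurable (cyl Q).
Proof.
rewrite (_ : cyl Q = \bigcup_(K in [set K | Q K]) cyl (pred1 K)); last first.
  apply/seteqP; split=> H /=; first by move=> QH; exists (trace n H) => //; apply/eqP.
  by move=> [K QK /eqP e]; rewrite /cyl /= e.
apply: fin_bigcup_measurable => // K _.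
rewrite (_ : cyl _ = \bigcap_(s in [set: {perm level k n}])
    (if s \in K then [set H : BSub (SDS k) | emb s \in sub_mem H]
     else ~` [set H : BSub (SDS k) | emb s \in sub_mem H])); last first.
  apply/seteqP; split=> H /= HK.
    by move=> s _; rewrite -(eqP HK) inE; case: ifPn => // /negP.
  apply/eqP/setP => s; rewrite inE; have := HK s I; case: ifP => //=.
  by move=> _ /negP/negbTE.
apply: fin_bigcap_measurable => [|s _]; first exact: finite_finset.
case: ifP => _; first exact: measurable_mem.
by apply: measurableC; exact: measurable_mem.
Qed.

(** The group is the union of its levels, so a neighbourhood of [H] contains every subgroup with the
    same trace as [H] at some level. Hence [U] is the countable union of the largest cylinders of
    each level inside it. *)
Lemma open_cyls (U : set (Sub (SDS k))) : open U -> <<s cyls >> U.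
Proof.
move=> [V oV VU].
pose Q n (K : {set {perm level k n}}) := `[< forall H, trace n H = K -> U H >].
rewrite (_ : U = \bigcup_n cyl (@Q n)); last first.
  apply/seteqP; split=> H; last by move=> [n _ /asboolP]; exact.
  rewrite -VU => VH.
  pose B n : set {ptws SDS k -> bool} :=
    [set h | forall s : {perm level k n}, h (emb s) = set_val H (emb s)].
  have BS n m : (n <= m)%N -> B m `<=` B n.
    move=> nm h hm t; have [Y [f [s [_ _ es _]]]] := level_split k nm.
    by rewrite -es hm.
  have FB : Filter (filter_from [set: nat] B).
    apply: filter_from_filter; first by exists 0.
    move=> i j _ _; exists (i + j)%N => // h hij.
    by split; apply: BS hij; rewrite ?leq_addr ?leq_addl.
  have cv : filter_from [set: nat] B --> (set_val H : {ptws SDS k -> bool}).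
    apply/cvg_sup => g W [W' [[C _ <-] CH] W'W].
    have [n gn] := emb_surj g; have [s gs] := gn n (leqnn n).
    by exists n => // h hn; apply: W'W => /=; rewrite gs hn -gs.
  have [|n _ BV] := cv V; first by rewrite nbhsE; exists V.
  exists n => //; apply/asboolP => H' e; rewrite -VU; apply: BV => s.
  have := congr1 (fun A : {set _} => s \in A) e; rewrite !inE.
  by rewrite !unfold_in.
apply: sigma_algebra_bigcup => n; apply: sub_sigma_algebra.
by exists n, (@Q n).
Qed.

Lemma measurable_cylsE : @measurable _ (BSub (SDS k)) = <<s cyls >>.
Proof.
apply/seteqP; split.
  by apply: smallest_sub; [exact: smallest_sigma_algebra|exact: open_cyls].
apply: smallest_sub; first exact: sigma_algebra_measurable.
by move=> _ [n [Q ->]]; exact: measurable_cyl.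
Qed.

Lemma cyl_measure_unique (R : realType) (m1 m2 : {measure set BSub (SDS k) -> \bar R}%R) :
  (m1 [set: BSub (SDS k)] < +oo)%E ->
  (forall n (Q : pred {set {perm level k n}}), m1 (cyl Q) = m2 (cyl Q)) ->
  forall A, measurable A -> m1 A = m2 A.
Proof.
move=> m1T m12 A mA.
apply: (measure_unique cyls (fun _ => [set: BSub (SDS k)]) measurable_cylsE cyls_setI) => //.
- by move=> _; exists 0, xpredT; apply/seteqP.
- by apply/seteqP; split=> // H _; exists 0.
- by move=> _ [n [Q ->]].
Qed.

Lemma measurable_cyl_preimage d (T : measurableType d) (f : T -> BSub (SDS k)) :
  (forall n (Q : pred {set {perm level k n}}), measurable (f @^-1` cyl Q)) ->
  measurable_fun [set: T] f.
Proof.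
move=> mf; apply: (measurability cyls); first exact: measurable_cylsE.
by move=> _ [_ [n [Q ->]] <-]; rewrite setTI.
Qed.

Lemma emb_level n (g : SDS k) : exists m (u : {perm level k m}), (n <= m)%N /\ g = emb u.
Proof.
have [i gi] := emb_surj g; have [u ->] := gi (n + i)%N (leq_addl _ _).
by exists (n + i)%N, u; rewrite leq_addr.
Qed.

Lemma conj_cyl n (Q : pred {set {perm level k n}}) u :
  (conj_sub (emb u) : BSub (SDS k) -> BSub (SDS k)) @^-1` cyl Q =
    cyl (fun K => Q (K :^ u^-1)).
Proof. by apply/seteqP; split=> H; rewrite /cyl /= trace_conj. Qed.

Lemma measurable_conj_sub (g : SDS k) :
  measurable_fun [set: BSub (SDS k)] (conj_sub g : BSub (SDS k) -> BSub (SDS k)).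
Proof.
apply: measurable_cyl_preimage => n Q.
have [m [u [nm ->]]] := emb_level n g; have [S ->] := cyl_lift Q nm.
by rewrite conj_cyl; exact: measurable_cyl.
Qed.

End Cylinders.

Local Open Scope ring_scope.

(** * Conjugation-invariant measures *)

Section Laws.
Variables (R : realType) (k : branching).
Local Notation BS := (BSub (SDS k)).

Definition law (mu : set BS -> \bar R) n (K : {set {perm level k n}}) : R :=
  fine (mu (cyl (pred1 K))).

(** The condition of [IRS] for set functions of any mass, such as a probability restricted to an
    invariant event. *)
Definition conj_invariant (mu : set BS -> \bar R) := forall (g : SDS k) A,
  measurable A -> mu ((conj_sub g : BS -> BS) @^-1` A) = mu A.

Section OneMeasure.
Variable mu : {measure set BS -> \bar R}.
Hypothesis muT : (mu [set: BS] < +oo)%E.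

Lemma fin_num_cyl n (Q : pred {set {perm level k n}}) : mu (cyl Q) \is a fin_num.
Proof.
rewrite ge0_fin_numE // (le_lt_trans _ muT) //.
by apply: le_measure; rewrite ?inE //; exact: measurable_cyl.
Qed.

Lemma cyl_law n (Q : pred {set {perm level k n}}) :
  mu (cyl Q) = (Pr (law mu (n := n)) Q)%:E.
Proof.
rewrite (_ : cyl Q = \bigcup_(K in [set` Q]) cyl (pred1 K)); last first.
  apply/seteqP; split=> H /=; first by move=> QH; exists (trace n H) => //; apply/eqP.
  by move=> [K QK /eqP e]; rewrite /cyl /= e.
rewrite measure_fin_bigcup; last by move=> K _; exact: measurable_cyl.
  rewrite -(@bigfs _ _ _ _ (index_enum {set {perm level k n}})) ?index_enum_uniq //.
    2: by move=> K _; rewrite mem_index_enum.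
  rewrite /Pr -sumEFin; apply: eq_bigr => K _.
  by rewrite /law fineK // fin_num_cyl.
- exact: finite_finset.
- by move=> K K' _ _ [H [/eqP <- /eqP <-]].
Qed.

Lemma law_weight n : conj_invariant mu -> weight (law mu (n := n)).
Proof.
move=> muJ; split=> [K|K|K u]; first exact: fine_ge0.
- apply: contra_neqT => nK; rewrite /law (_ : cyl _ = set0) ?measure0 //.
  apply/seteqP; split=> // H /eqP e; move: nK; rewrite -e => /negP; apply.
  exact: group_trace.
- rewrite /law -[in RHS](muJ (emb u)); last exact: measurable_cyl.
  rewrite conj_cyl; congr (fine (mu (cyl _))); apply/funext => K' /=.
  by apply/eqP/eqP => [->|<-]; rewrite -?conjsgM ?mulgV ?mulVg conjsg1.
Qed.

End OneMeasure.

Definition off_class n (K0 : {set {perm level k n}}) : pred {set {perm level k n}} :=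
  fun K => K \notin K0 :^: [set: {perm level k n}]%SET.

(** A cylinder of level [n] is also one of every higher level [m]. Where both measures are within
    [e] of a single conjugacy class, [Pr_close] bounds their difference by [e + e], and [e] is
    arbitrary. *)
Lemma concentrated_unique (mu nu : {measure set BS -> \bar R}) c
    (K0 : forall n, {set {perm level k n}}) :
  conj_invariant mu -> conj_invariant nu ->
  mu [set: BS] = c%:E -> nu [set: BS] = c%:E ->
  (forall (e : R) n, 0 < e -> exists m, [/\ (n <= m)%N,
     (mu (cyl (off_class (K0 m))) <= e%:E)%E & (nu (cyl (off_class (K0 m))) <= e%:E)%E]) ->
  forall A, measurable A -> mu A = nu A.
Proof.
move=> muJ nuJ muT nuT conc.
have muT' : (mu [set: BS] < +oo)%E by rewrite muT ltry.
have nuT' : (nu [set: BS] < +oo)%E by rewrite nuT ltry.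
apply: cyl_measure_unique => // n Q.
have TE m : cyl (xpredT : pred {set {perm level k m}}) = setT by apply/seteqP.
have E m : Pr (law mu (n := m)) xpredT = Pr (law nu (n := m)) xpredT.
  by apply: EFin_inj; rewrite -!cyl_law // TE muT nuT.
rewrite !cyl_law //; congr (_%:E).
have close (e : R) : 0 < e -> `|Pr (law mu (n := n)) Q - Pr (law nu (n := n)) Q| <= e + e.
  move=> e0; have [m [nm]] := conc e n e0; rewrite !cyl_law // !lee_fin => e1 e2.
  have [Q' QQ'] := cyl_lift Q nm.
  rewrite (_ : Pr (law mu (n := n)) Q = Pr (law mu (n := m)) Q'); last first.
    by apply: EFin_inj; rewrite -!cyl_law // QQ'.
  rewrite (_ : Pr (law nu (n := n)) Q = Pr (law nu (n := m)) Q'); last first.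
    by apply: EFin_inj; rewrite -!cyl_law // QQ'.
  have w1 := law_weight m muJ; have w2 := law_weight m nuJ.
  have := Pr_close w1 w2 (E m) Q' e1 e2.
  have := Pr_close w2 w1 (esym (E m)) Q' e2 e1.
  by rewrite ler_norml; lra.
apply/eqP; rewrite -subr_eq0 -normr_le0; apply/ler_addgt0Pl => e e0; rewrite addr0.
by have := close (e / 2); rewrite divr_gt0 // => /(_ isT); lra.
Qed.

Lemma concentrated_ergodic (la : probability BS R) (K0 : forall n, {set {perm level k n}}) :
  IRS la ->
  (forall (e : R) n, 0 < e ->
     exists2 m, (n <= m)%N & (la (cyl (off_class (K0 m))) <= e%:E)%E) ->
  ergodic_IRS la.
Proof.
move=> laJ conc; split=> // A mA AJ.
have laA : la A \is a fin_num by exact: fin_num_measure.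
have laA0 : 0 <= fine (la A) by exact: fine_ge0.
(* If [la] and its restriction to [A] agree up to scaling, then [la A = la A ^ 2]. *)
pose nu := mscale (NngNum laA0) la.
have le1 : fine (la A) <= 1 by rewrite -lee_fin fineK // probability_le1.
have H : forall B, measurable B -> mrestr la mA B = nu B.
  apply: (@concentrated_unique _ _ (fine (la A)) K0).
  - move=> g B mB; rewrite /= /mrestr.
    transitivity (la ((conj_sub g : BS -> BS) @^-1` (B `&` A))).
      by rewrite preimage_setI AJ.
    by apply: laJ; exact: measurableI.
  - by move=> g B mB; rewrite /= /nu /mscale; congr (_ * _)%E; exact: laJ.
  - by rewrite /= /mrestr setTI fineK.
  - by rewrite /= /mscale [X in (_ * X)%E]probability_setT mule1.
  - move=> e n e0; have [m nm le] := conc e n e0; exists m; split=> //.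
      apply: le_trans le; rewrite /= /mrestr; apply: le_measure; rewrite ?inE //.
      by apply: measurableI => //; exact: measurable_cyl.
      exact: measurable_cyl.
    apply: le_trans le; rewrite /= /nu /mscale /=.
    by rewrite gee_pMl // fin_num_measure //; exact: measurable_cyl.
have := H A mA; rewrite /mrestr setIid /nu /mscale /= fineK // => e.
have {}e : fine (la A) = fine (la A) * fine (la A) by rewrite -fineM // -e.
have : fine (la A) * (fine (la A) - 1) == 0 by rewrite mulrBr mulr1 -e subrr.
by rewrite mulf_eq0 subr_eq0 -{3 4}(fineK laA) => /orP[]/eqP->; [left|right].
Qed.

End Laws.

Lemma nat_mul_ge (R : realType) (c : R) : 0 < c -> exists M : nat, (0 < M)%N /\ 2 <= M%:R * c.
Proof.
move=> c0; exists (Num.truncn (2 / c)).+1; split=> //.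
by rewrite -ler_pdivrMr // ltW // truncnS_gt.
Qed.

Lemma finite_uniform (I : finType) (Q : I -> nat -> Prop) :
  (forall i a b, (a <= b)%N -> Q i a -> Q i b) ->
  (forall i, exists a, Q i a) -> exists a, forall i, Q i a.
Proof.
move=> QS /choice[a Qa]; exists (\max_i a i)%N => i.
by apply: QS (Qa i); exact: leq_bigmax.
Qed.

(** * Reference conjugacy classes for traces *)

Section Normal.
Variable k : branching.

Definition base_set n r : {set level k n} := [set x in take r (enum (level k n))]%SET.

(** A representative only: by [on_class] the first [r] points could be replaced by any [r] points
    without changing the conjugacy class. *)
Definition base_group (N : Sub (SDS k)) r n : {set {perm level k n}} :=
  'C(base_set n r | 'P) :&: trace n N.

Lemma trace_normal (N : Sub (SDS k)) n u : normal_sub N -> trace n N :^ u = trace n N.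
Proof.
by move=> NN; rewrite -[in RHS](NN (emb u^-1)) trace_conj invgK.
Qed.

Lemma on_class (N : Sub (SDS k)) r n (D : {set level k n}) : normal_sub N -> #|D| = r ->
  ~~ off_class (base_group N r n) ('C(D | 'P) :&: trace n N).
Proof.
move=> NN Dr; rewrite negbK.
have rX : (r <= #|level k n|)%N by rewrite -Dr max_card.
have [u uD] : exists u : {perm level k n}, u @: base_set n r = D.
  apply: perm_set_trans; rewrite Dr cardsE (card_uniqP _) ?take_uniq ?enum_uniq //.
  by rewrite size_take_min -cardE; apply/minn_idPl.
apply/imsetP; exists u; first by rewrite inE.
by rewrite conjIg -fixJ uD trace_normal.
Qed.

Lemma normal_whole : normal_sub (whole_sub (SDS k)).
Proof. by move=> g; apply: Sub_ext => x; rewrite !unfold_in. Qed.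

Lemma normal_triv : normal_sub (triv_sub (SDS k)).
Proof.
by move=> g; apply: Sub_ext => x; rewrite !unfold_in /= conjg_eq1.
Qed.

Lemma normal_alt : normal_sub (alt_sub k).
Proof.
have altJ (x g : SDS k) : alt_mem x -> alt_mem (x ^ g)%g.
  move=> /alt_mem_le[n Hn]; have [m [u [nm ->]]] := emb_level n g.
  have [s As ->] := Hn m nm; apply/asboolP; exists m, (s ^ u)%g.
  rewrite -/(emb s) -/(emb (s ^ u)%g) embJ; split=> //.
  by rewrite Alt_even odd_permJ -Alt_even.
move=> g; apply: Sub_ext => x; rewrite !unfold_in /=; apply/idP/idP; last exact: altJ.
by move=> /altJ -/(_ g^-1%g); rewrite conjgK.
Qed.

End Normal.

(** * Traces of an ergodic invariant random subgroup *)

Section Random.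
Variables (R : realType) (k : branching) (la : probability (BSub (SDS k)) R).
Hypothesis laJ : IRS la.
Local Notation BS := (BSub (SDS k)).
Local Notation P n := (Pr (law la (n := n))).

Lemma prob_fin : (la [set: BS] < +oo)%E.
Proof. by rewrite probability_setT ltry. Qed.

Lemma prob_cyl n (Q : pred {set {perm level k n}}) : la (cyl Q) = (P n Q)%:E.
Proof. by apply: (@cyl_law R k la); exact: prob_fin. Qed.

Lemma law_wt n : weight (law la (n := n)).
Proof. exact: (@law_weight R k la n laJ). Qed.
#[local] Hint Resolve law_wt : core.

Lemma law_mass n : P n xpredT = 1.
Proof.
apply: EFin_inj; rewrite -prob_cyl -(probability_setT la); congr (la _).
by apply/seteqP.
Qed.

Lemma Pr_law_eq n m (Q : pred {set {perm level k n}}) (Q' : pred {set {perm level k m}}) :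
  cyl Q = cyl Q' -> P n Q = P m Q'.
Proof. by move=> e; apply: EFin_inj; rewrite -!prob_cyl e. Qed.

Lemma Pr_law_emb n m (s : {perm level k n}) (t : {perm level k m}) : emb s = emb t ->
  P n (fun K => s \in K) = P m (fun K => t \in K).
Proof.
by move=> e; apply: Pr_law_eq; apply/seteqP; split=> H; rewrite /cyl /= !inE e.
Qed.

Lemma Pr_law_compl n (Q : pred {set {perm level k n}}) : P n (fun K => ~~ Q K) = 1 - P n Q.
Proof.
by rewrite -(law_mass n) /Pr [X in _ = X - _](bigID Q) /= addrAC subrr add0r.
Qed.

Definition vanishing (Q : forall n, pred {set {perm level k n}}) :=
  forall e : R, 0 < e -> exists N, forall n, (N <= n)%N -> P n (Q n) <= e.

Lemma cyl_decr_cvg (Q : forall n, pred {set {perm level k n}}) :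
  (forall n m, (n <= m)%N -> cyl (Q m) `<=` cyl (Q n)) ->
  la (\bigcap_n cyl (Q n)) = 0 -> vanishing Q.
Proof.
move=> QS Q0 e e0.
have mc n : measurable (cyl (Q n)) by exact: measurable_cyl.
have : la \o (fun n => cyl (Q n)) @ \oo --> la (\bigcap_n cyl (Q n)).
  apply: nonincreasing_cvg_mu => //.
  - by rewrite (le_lt_trans (probability_le1 la (mc 0%N))) // ltry.
  - exact: bigcapT_measurable.
  - by move=> n m nm; apply/subsetPset; exact: QS.
rewrite Q0 => /fine_cvgP[_] /cvgrPdist_le /(_ e e0)[N _ NP].
exists N => n Nn; have := NP n Nn; rewrite /= prob_cyl /= sub0r normrN.
exact: le_trans (ler_norm _).
Qed.

(** The intersection of the events is conjugation invariant, so ergodicity gives it measure 0 or 1;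
    in the first case continuity from above applies. *)
Lemma zero_one_decr (Q : forall n, pred {set {perm level k n}}) :
  ergodic_IRS la ->
  (forall n m, (n <= m)%N -> cyl (Q m) `<=` cyl (Q n)) ->
  (forall n (K : {set {perm level k n}}) u, Q n (K :^ u)%g = Q n K) ->
  (forall n, P n (Q n) = 1) \/ vanishing Q.
Proof.
move=> [_ erg] QS QJ; have mc n : measurable (cyl (Q n)) by exact: measurable_cyl.
have mE : measurable (\bigcap_n cyl (Q n)) by exact: bigcapT_measurable.
have inv (g : SDS k) H : (\bigcap_n cyl (Q n)) (conj_sub g H) <-> (\bigcap_n cyl (Q n)) H.
  (* Any [g] comes from some level [m >= n], where [Q m] is invariant; monotonicity brings the event
     back to level [n]. *)
  by split=> EH n _; have [m [u [nm gu]]] := emb_level n g; apply: (QS _ _ nm);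
    have := EH m I; rewrite gu /cyl /= trace_conj QJ.
have [|E0|E1] := erg _ mE.
- by move=> g; apply/seteqP; split=> H; rewrite /preimage /= => /(inv g).
- by right; exact: cyl_decr_cvg.
left=> n; apply/le_anti; rewrite Pr_le1 //=; last exact: law_mass.
rewrite -lee_fin -prob_cyl -E1; apply: le_measure; rewrite ?inE //.
by move=> H; apply.
Qed.

(** One level supplies an element [h] with a fixed point. Higher up, this point has as many copies
    as there are tails, all fixed by the image of [h], which is what [c3_likely] needs. *)
Lemma three_cycles n (g : {perm level k n}) : g != 1%g -> 0 < P n (fun K => g \in K) ->
  exists (d : R) N, 0 < d <= 1 /\ forall m, (N <= m)%N ->
    forall a b c : level k m, b != a -> c != a -> c != b ->
    d <= P m (fun K => c3 a b c \in K).
Proof.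
move=> g1 gc; have [M [_ Mc]] := nat_mul_ge gc.
have [Y1 [f1 [s1 [bf1 fs1 es1 _]]]] := level_split k (leq_addr (M + 7) n).
set m1 := (n + (M + 7))%N in f1 s1 bf1 fs1 es1.
have Mm1 : (M + 7 <= #|level k m1|)%N.
  by rewrite (leq_trans (leq_addl n _)) // ltnW // ltn_level.
have h1 : s1 g != 1%g.
  apply: contraNneq g1 => e; rewrite -(inj_eq (@emb_inj k n)) -es1 e !emb1.
  exact: eqxx.
have [h [hN1 [x0 hx0] hc]] := fixing_conjugate (law_wt m1) (law_mass m1) h1
  (Pr_law_emb (es1 g)) Mc Mm1.
have [M' [M'0 M'c]] := nat_mul_ge hc.
have [x hx] := perm_neq1 hN1.
(* The bound is the one of [c3_likely], weakened so that it is at most 1; the threshold ensures at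
   least [M'] tails above level [m1]. *)
exists (M'%:R ^- 2), (m1 + #|level k m1| * M')%N; split.
  rewrite invr_gt0 exprn_gt0 ?ltr0n //= invf_le1 ?exprn_gt0 ?ltr0n //.
  by rewrite exprn_ege1 // ler1n.
move=> m mm a b c ba ca cb.
have [Y [f [s [bf fs es _]]]] := level_split k (leq_trans (leq_addr _ _) mm).
have YM : (M' <= #|Y|)%N.
  rewrite leqNgt; apply/negP => YM; have := bij_eq_card bf.
  rewrite card_prod => e; have := ltn_level k m; rewrite e ltnNge.
  rewrite (leq_trans _ mm) // (leq_trans _ (leq_addl _ _)) // leq_mul2l ltnW ?orbT //.
case: (bf) => f' fK f'K.
pose y (i : 'I_M') := f' (x0, enum_val (widen_ord YM i)).
have yI : injective y.
  move=> i j /(can_inj f'K)[] /enum_val_inj e; apply: val_inj; exact: (congr1 val e).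
have yo : (0 < #|Y|)%N := leq_trans M'0 YM.
have /card_gt0P[z0 _] := yo.
have sx : s h (f' (x, z0)) != f' (x, z0).
  apply: contraNneq hx => e; have := fs h (f' (x, z0)).
  by rewrite e f'K /= => -[<-].
have sy i : s h (y i) = y i.
  by apply: (can_inj fK); rewrite fs /y f'K /= hx0.
have := c3_likely (law_wt m) (law_mass m) yI sx sy (esym (Pr_law_emb (esym (es h))))
  M'c ba ca cb.
have : 0 < M'%:R ^+ 2 :> R by rewrite exprn_gt0 // ltr0n.
move=> M2 H; rewrite -[leLHS]mul1r ler_pdivrMr // mulrC; lra.
Qed.

Lemma has_core_decr l n m : (n <= m)%N ->
  @cyl k m (@has_core _ l) `<=` @cyl k n (@has_core _ l).
Proof.
move=> nm H /existsP[D /andP[mD Dl]]; have [D' [nD' D'D]] := core_proj nm mD.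
by apply/existsP; exists D'; rewrite nD' (leq_trans D'D).
Qed.

Lemma trace_gt1 : vanishing (fun n K => K \subset [1]%g) ->
  exists n (g : {perm level k n}), g != 1%g /\ 0 < P n (fun K => g \in K).
Proof.
move=> /(_ (2^-1)) []; first by rewrite invr_gt0.
move=> m /(_ m (leqnn m)) H; apply: contrapT => nE.
have H0 (g : {perm level k m}) : g != 1%g -> P m (fun K => g \in K) = 0.
  move=> g1; apply/le_anti; rewrite Pr_ge0 ?andbT // leNgt.
  apply/negP => g0.
  by apply: nE; exists m, g.
have : P m xpredT <= P m (fun K => K \subset [1]%g) +
    P m (fun K => [exists g : {perm level k m}, (g != 1%g) && (g \in K)]).
  apply: Pr_or => // K _; have [//|/fintype.subsetPn[g Kg g1]] := boolP (K \subset [1]%g).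
  by apply/existsP; exists g; rewrite Kg andbT; rewrite inE in g1.
have : P m (fun K => [exists g : {perm level k m}, (g != 1%g) && (g \in K)]) <=
    \sum_(g : {perm level k m} | g != 1%g) P m (fun K => g \in K).
  by apply: Pr_union => // K /existsP[g /andP[g1 Kg]]; exists g.
rewrite law_mass [X in _ <= X -> _]big1; last exact: H0.
by lra.
Qed.

(** Either [h] keeps the class of [a] or moves it off itself, and the two swapping estimates apply.
    The number of points moved by [h] grows in proportion to the level, which lets [l] be
    independent of [m]. *)
Lemma lift_unlikely n (g : {perm level k n}) (d e : R) : g != 1%g -> 0 < d -> 0 < e ->
  exists l N, forall m (h : {perm level k m}) a, (N <= m)%N -> emb h = emb g ->
    P m (fun K => [&& h \in K, d * #|level k m|%:R <= #|lclass K a|%:R :> R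
                     & (l <= #|~: lclass K a|)%N]) <= e.
Proof.
move=> g1 d0 e0; pose N1 : R := #|level k n|%:R.
have N10 : 0 < N1 by rewrite ltr0n level_gt0.
(* [h] moves at least [#|Y|] points out of [N1 * #|Y|], so the first estimate gives about
   [8 * N1 / L], at most [e / 2]. *)
pose L := (Num.truncn (16 * N1 / e)).+1.
have Le : 16 * N1 <= e * L%:R.
  by rewrite [leRHS]mulrC -ler_pdivrMr // ltW // truncnS_gt.
pose B (x : R) := (Num.truncn x).+1.
have BE x : x <= (B x)%:R by rewrite ltW // truncnS_gt.
(* Apart from [n], the summands ensure in turn [2 <= #|Y|], [8 <= d * N], [L.+1 <= d * N] and
   [16 <= d ^+ 2 * e * N], where [N] is the size of level [m]. *)
exists L.+1, (n + 2 * #|level k n| + B (8 / d) + B (L.+1%:R / d) + B (16 / (d ^+ 2 * e)))%N.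
move=> m h a Nm hg; have mN := ltnW (ltn_level k m).
pose N : R := #|level k m|%:R; rewrite -/N.
have le_N x : (B x <= m)%N -> x <= N.
  by move=> xm; rewrite (le_trans (BE x)) // ler_nat (leq_trans xm).
have nm : (n <= m)%N by apply: leq_trans Nm; rewrite -!addnA leq_addr.
have N8 : 8 <= d * N.
  rewrite mulrC -ler_pdivrMr //; apply: le_N; apply: leq_trans Nm.
  by rewrite -addnA -addnA addnC -addnA leq_addr.
have NL : L.+1%:R <= d * N.
  rewrite mulrC -ler_pdivrMr //; apply: le_N; apply: leq_trans Nm.
  by rewrite -addnA addnC -addnA leq_addr.
have Ne : 16 <= d ^+ 2 * e * N.
  rewrite mulrC -ler_pdivrMr ?mulr_gt0 ?exprn_gt0 //; apply: le_N; apply: leq_trans Nm.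
  by rewrite leq_addl.
have m2 : (2 * #|level k n| <= m)%N.
  apply: leq_trans Nm; rewrite -2!addnA.
  exact: leq_trans (leq_addl n _) (leq_addr _ _).
have [Y [f [s [bf fs es _]]]] := level_split k nm.
have NE : #|level k m| = (#|level k n| * #|Y|)%N by rewrite (bij_eq_card bf) card_prod.
have Y2 : (2 <= #|Y|)%N.
  rewrite leqNgt; apply/negP => Y2; have := leq_ltn_trans m2 (ltn_level k m).
  by rewrite NE mulnC ltn_mul2l; case: #|Y| Y2 => [|[|y]] //; rewrite andbF.
have {hg}hs : h = s g by apply: (@emb_inj k m); rewrite es.
have supp : (#|Y| <= #|[set x | h x != x]%SET|)%N.
  have [x gx] := perm_neq1 g1.
  case: (bf) => f' fK f'K.
  have fI : injective (fun y => f' (x, y)) by move=> y y' /(can_inj f'K)[].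
  rewrite -(card_codom fI); apply/subset_leq_card/fintype.subsetP => w.
  move=> /codomP[y ->]; rewrite inE; apply: contraNneq gx => E.
  by have := fs g (f' (x, y)); rewrite -hs E f'K => -[<-].
set S := #|[set x | h x != x]%SET| in supp.
(* Since [d * N >= 8], both [b] and [b - 2] are at least half of [d * N]. *)
pose b := Num.truncn (d * N).
have bN : b%:R <= d * N by rewrite truncn_le // mulr_ge0 // ltW.
have Nb : d * N < b%:R + 1 by rewrite natr1 truncnS_gt.
apply: (@le_trans _ _ (P m (fun K => [&& h \in K, link K a (h a),
    (L.+1 <= #|lclass K a|)%N & (L.+1 <= #|~: lclass K a|)%N]) +
  P m (fun K => [&& h \in K, ~~ link K a (h a) & (b <= #|lclass K a|)%N]))).
  apply: Pr_or => // K /and3P[-> dK ->] /=; rewrite andbT.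
  rewrite -(ler_nat R) (le_trans NL dK) /=.
  by rewrite -(ler_nat R b) (le_trans bN dK) !andbT orbN.
have I1 := invariant_class_unlikely (law_wt m) (law_mass m) h a L.+1.
have I2 := moving_class_unlikely (law_wt m) (law_mass m) h a b.
rewrite -/S -/N in I1 I2.
set p1 := P m _ in I1 *; set p2 := P m _ in I2 *.
have p10 : 0 <= p1 by exact: Pr_ge0.
have p20 : 0 <= p2 by exact: Pr_ge0.
have P1e : p1 <= e / 2.
  pose q : R := #|Y|%:R.
  have q2 : 2 <= q by rewrite (ler_nat R 2).
  have NE' : N = N1 * q by rewrite /N NE natrM.
  have Sq : q - 1 <= S.-1%:R.
    by rewrite lerBlDr natr1 ler_nat (leq_trans supp) // leqSpred.
  rewrite natrM /= in I1.
  have : (q - 1) * L%:R * p1 <= 4 * N.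
    by apply: le_trans I1; rewrite ler_wpM2r //; apply: ler_wpM2r => //; exact: Sq.
  have L0 : 0 < L%:R :> R by rewrite ltr0n.
  rewrite NE' => H.
  have {}H : (q - 1) * (L%:R * p1) <= (q - 1) * (8 * N1) by nra.
  rewrite ler_pM2l in H; last by lra.
  rewrite -(ler_pM2l L0); lra.
have P2e : p2 <= e / 2.
  rewrite natrM in I2.
  have b2 : b%:R - 2 <= b.-2%:R :> R.
    by rewrite lerBlDr -natrD ler_nat addn2; case: (b) => [|[|]].
  set x := d * N in N8 NL bN Nb.
  have : (x / 2) * (x / 2) * p2 <= 2 * N.
    apply: le_trans I2; rewrite ler_wpM2r //; apply: ler_pM; lra.
  have N0 : 0 < N by rewrite ltr0n level_gt0.
  rewrite /x => H.
  have {}H : N * (d ^+ 2 * N * p2) <= N * 8 by rewrite expr2; nra.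
  rewrite ler_pM2l // in H.
  have d2 : 0 < d ^+ 2 * N by rewrite mulr_gt0 // exprn_gt0.
  rewrite -(ler_pM2l d2); lra.
lra.
Qed.

(** Otherwise, by the zero-one law, each bound [l] on the core size becomes unlikely. But the class
    of a point is large with probability at least [d / 2], and then its complement is a small core,
    the trace at level [n] is trivial, or [lift_unlikely] applies. *)
Lemma bounded_core : ergodic_IRS la ->
  vanishing (fun n K => K \subset [1]%g) ->
  exists l, forall n, P n (@has_core _ l) = 1.
Proof.
move=> erg triv0; apply: contrapT => nl.
have core0 l : vanishing (fun n => @has_core _ l).
  have [E|//] := zero_one_decr erg (@has_core_decr l) (fun n K u => has_coreJ l K u).
  by case: nl; exists l.
have [n0 [g0 [g01 g0c]]] := trace_gt1 triv0.
have [d [N1 [/andP[d0 d1] c3d]]] := three_cycles g01 g0c.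
have [n /(_ n (leqnn n)) triv] := triv0 (d / 8) (divr_gt0 d0 (ltr0Sn _ _)).
have d2 : 0 < d / 2 by lra.
(* The budget: [d / 8] for a trivial trace, [d / 8] for a small core, and [d / 16] for all
   nontrivial elements of level [n] together. *)
have arith : ~ (d / 2 <= d / 8 + d / 8 + d / 16) by lra.
pose c : R := #|{perm level k n}|%:R.
have c0 : 0 < c by rewrite ltr0n; apply/card_gt0P; exists 1%g.
have e0 : 0 < d / 16 / c by rewrite !divr_gt0.
pose ok (g : {perm level k n}) l N := g != 1%g ->
  forall m (h : {perm level k m}) a, (N <= m)%N -> emb h = emb g ->
    P m (fun K => [&& h \in K, d / 2 * #|level k m|%:R <= #|lclass K a|%:R :> R
                     & (l <= #|~: lclass K a|)%N]) <= d / 16 / c.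
(* First [l] and then [N] are made uniform over the finitely many [g], since the level chosen from
   [core0] depends on [l]. *)
have [l Hl] : exists l, forall g : {perm level k n}, exists N, ok g l N.
  apply: finite_uniform => [g a b ab [N gN]|g]; last first.
    have [->|g1] := eqVneq g 1%g; first by exists 0%N, 0%N; rewrite /ok eqxx.
    have [l [N gN]] := lift_unlikely g1 d2 e0.
    by exists l, N => _; exact: gN.
  exists N => g1 m h x Nm hg; apply: le_trans (gN g1 m h x Nm hg).
  by apply: Pr_sub => // K /and3P[-> -> bK] /=; exact: leq_trans bK.
have [N HN] : exists N, forall g : {perm level k n}, ok g l N.
  apply: finite_uniform => // g a b ab gN g1 m h x bm hg.
  by apply: gN => //; exact: leq_trans bm.
have [N2 N2P] := core0 l (d / 8) (divr_gt0 d0 (ltr0Sn _ _)).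
pose m := (n + N + N1 + N2 + 3)%N.
have nm : (n <= m)%N by rewrite /m -!addnA leq_addr.
have Nm : (N <= m)%N by rewrite /m; lia.
have N1m : (N1 <= m)%N by rewrite /m; lia.
have N2m : (N2 <= m)%N by rewrite /m; lia.
have m3 : (3 <= #|level k m|)%N 
  by rewrite ltnW // (leq_ltn_trans _ (ltn_level k m)) // /m leq_addl.
have d01 : 0 <= d <= 1 by rewrite (ltW d0).
pose a : level k m := prefix m point.
have big := lclass_large (law_wt m) (law_mass m) a d01 m3 (c3d m N1m).
have [Y [f [s [bf fs es _]]]] := level_split k nm.
have triv' : P m (fun K : {set _} => s @^-1: K \subset [1]%g) <= d / 8.
  apply: le_trans triv; rewrite le_eqVlt; apply/orP; left; apply/eqP; apply: Pr_law_eq.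
  by apply/seteqP; split=> H; rewrite /cyl /= trace_preim.
pose F (K : {set {perm level k m}}) := d / 2 * #|level k m|%:R <= #|lclass K a|%:R :> R.
pose A (g : {perm level k n}) (K : {set {perm level k m}}) :=
  [&& s g \in K, F K & (l <= #|~: lclass K a|)%N].
have S1 : P m F <= P m (fun K : {set _} => (s @^-1: K \subset [1]%g) || has_core l K) +
    P m (fun K => [exists g, (g != 1%g) && A g K]).
  apply: Pr_or => // K FK.
  have [//|/fintype.subsetPn[g Kg g1]] := boolP (s @^-1: K \subset [1]%g).
  have [//|nK] /= := boolP (has_core l K).
  apply/existsP; exists g; rewrite !inE in Kg g1; rewrite g1 /A Kg FK /=.
  rewrite leqNgt; apply: contra nK => cl; apply/existsP; exists (~: lclass K a)%SET.
  by rewrite core_lclass ltnW.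
have S2 : P m (fun K : {set _} => (s @^-1: K \subset [1]%g) || has_core l K) <= d / 8 + d / 8.
  apply: le_trans (lerD triv' (N2P m N2m)); exact: Pr_or.
have S3 : P m (fun K => [exists g, (g != 1%g) && A g K]) <= \sum_(g | g != 1%g) P m (A g).
  by apply: Pr_union => // K /existsP[g /andP[g1 gA]]; exists g.
have S4 : \sum_(g | g != 1%g) P m (A g) <= \sum_(g : {perm level k n}) d / 16 / c.
  rewrite [leLHS]big_mkcond; apply: ler_sum => g _; case: ifP => g1; last exact: ltW.
  exact: (HN g g1 m (s g) a Nm (es g)).
rewrite sumr_const -[X in _ <= X]mulr_natr -/c divfK in S4; last exact: lt0r_neq0.
exact: arith (le_trans (le_trans big S1) (lerD S2 (le_trans S3 S4))).
Qed.

(** [r] is the least bound valid almost surely, so by the zero-one law a core of size at most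
    [r - 1] becomes unlikely. *)
Lemma core_rank : ergodic_IRS la ->
  vanishing (fun n K => K \subset [1]%g) ->
  exists r, vanishing (fun n K => ~~ at_core r K).
Proof.
move=> erg triv0; have [l0 Hl0] := bounded_core erg triv0.
have ex : exists l, `[< forall n, P n (@has_core _ l) = 1 >] by exists l0; apply/asboolP.
case: (ex_minnP ex) => r /asboolP r1 rmin; exists r => e e0.
have [N HN] : exists N, forall n, (N <= n)%N ->
    P n (fun K : {set _} => (0 < r)%N && has_core r.-1 K) <= e.
  case: (posnP r) => [r0|r0].
    by exists 0%N => n _; rewrite r0 /Pr big1 // ltW.
  have [E|] := zero_one_decr erg (@has_core_decr r.-1) (fun n K u => has_coreJ r.-1 K u).
    have /rmin : `[< forall n, P n (@has_core _ r.-1) = 1 >] by apply/asboolP.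
    by rewrite leqNgt prednK // leqnn.
  by move=> /(_ e e0).
exists N => n Nn; apply: le_trans (HN n Nn).
rewrite -[leRHS]add0r -(subrr 1) -{2}(r1 n) -Pr_law_compl; apply: Pr_or => // K nK.
have [/existsP[D /andP[KD Dr]] /=|//] := boolP (has_core r K).
apply: contraR nK => nK; apply/existsP; exists D.
have Kmin D' : core K D' -> (r <= #|D'|)%N.
  move=> KD'; rewrite leqNgt; apply: contra nK => D'r.
  have r0 : (0 < r)%N by exact: leq_ltn_trans D'r.
  by rewrite r0; apply/existsP; exists D'; rewrite KD' -ltnS prednK.
by apply/mincoreP; split=> //; apply/eqP; rewrite eqn_leq Dr Kmin.
Qed.

(** The event lives at level [n], so its probability can be computed at any higher level [m]. There
    it forces a failure of [at_core] or two core points with equal tails, and both are unlikely as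
    [m] grows. *)
Lemma core_fixed r n : vanishing (fun n K => ~~ at_core r K) ->
  (r + r + 3 <= #|level k n|)%N ->
  P n (fun K => [exists D : {set _}, mincore r K D && ~~ (K \subset 'C(D | 'P))]) = 0.
Proof.
move=> rk rn; apply/le_anti; rewrite Pr_ge0 ?andbT //.
apply/ler_addgt0Pl => e e0; rewrite addr0.
have e2 : 0 < e / 2 by lra.
have [N HN] := rk _ e2.
(* Each tail is shared by at most [#|level k n|] points, so [tail_coincidence] gives at most
   [c / m]. *)
pose c : R := #|level k n|%:R * (r * r)%:R.
have c0 : 0 <= c by rewrite mulr_ge0.
pose m := (n + N + (Num.truncn (c / (e / 2))).+1)%N.
have nm : (n <= m)%N by rewrite /m -addnA leq_addr.
have Nm : (N <= m)%N by rewrite /m addnAC leq_addl.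
have [Y [f [s [bf fs es As]]]] := level_split k nm.
have NE : #|level k m| = (#|level k n| * #|Y|)%N by rewrite (bij_eq_card bf) card_prod.
have rm : (r + r + 3 <= #|level k m|)%N.
  rewrite (leq_trans rn) // NE leq_pmulr //.
  by have := level_gt0 k m; rewrite NE; case: #|Y| => [|//]; rewrite muln0.
have fib y : (#|[set x | (f x).2 == y]%SET| <= #|level k n|)%N.
  rewrite -(card_in_imset (f := fun x => (f x).1)) ?max_card //.
  move=> x x'; rewrite !inE => /eqP xy /eqP x'y xx'; apply: (bij_inj bf).
  by rewrite (surjective_pairing (f x)) xx' xy -x'y -surjective_pairing.
have V := tail_coincidence (law_wt m) (law_mass m) (tl := fun x => (f x).2) fib rm.
set p := Pr _ _ in V.
have pe : p <= e / 2.
  have m0 : 0 < m%:R :> R by rewrite ltr0n /m addnS.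
  have : m%:R * p <= c.
    rewrite /c -natrM; apply: le_trans V; apply: ler_wpM2r; first exact: Pr_ge0 (law_wt m) _.
    by rewrite ler_nat -ltnS prednK ?level_gt0 // ltn_level.
  have : c <= m%:R * (e / 2).
    rewrite -ler_pdivrMr // (@le_trans _ _ (Num.truncn (c / (e / 2))).+1%:R) //.
      by rewrite ltW // truncnS_gt.
    by rewrite ler_nat leq_addl.
  move=> H1 H2; rewrite -(ler_pM2l m0); lra.
rewrite [e]splitr; apply: le_trans (lerD (HN m Nm) pe).
have -> : P n (fun K => [exists D : {set _}, mincore r K D && ~~ (K \subset 'C(D | 'P))]) =
   P m (fun K : {set _} => [exists D : {set _},
     mincore r (s @^-1: K) D && ~~ (s @^-1: K \subset 'C(D | 'P))]).
  by apply: Pr_law_eq; apply/seteqP; split=> H; rewrite /cyl /= trace_preim.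
(* An element of the trace that moves a point of [D] lifts to one that keeps the
   second coordinate, so the minimal core upstairs has two points with the same
   second coordinate. *)
apply: Pr_or => // K /existsP[D /andP[JD nJ]].
have [/existsP[D' KD'] /=|//] := boolP (at_core r K).
have sM : {morph s : t u / (t * u)%g}.
  by move=> t u; apply: (@emb_inj k m); rewrite es !embM !es.
have gJ : group_set (s @^-1: K).
  apply/group_setP; split=> [|t u]; rewrite !inE ?sM; last exact: groupM.
  by rewrite (_ : s 1%g = 1%g) //; apply: (@emb_inj k m); rewrite es !emb1.
have [_ _ Dmin] := mincoreP _ _ _ JD; have [/fintype.subsetP KD'c D'r _] := mincoreP _ _ _ KD'.
pose D2 := [set (f w).1 | w in D']%SET.
have JD2 : core (s @^-1: K) D2.
  apply/fintype.subsetP => t /altfixP[ft At]; rewrite inE.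
  apply: KD'c; apply/altfixP; split=> [w wD|]; last exact: As.
  apply: (bij_inj bf); rewrite fs ft; last exact: imset_f.
  by rewrite -surjective_pairing.
have D2r : (#|D2| <= r)%N by rewrite -D'r leq_imset_card.
have mD2 : mincore r (s @^-1: K) D2.
  by apply/mincoreP; split=> //; apply/eqP; rewrite eqn_leq D2r Dmin.
have DD2 := mincore_uniq (K := group gJ) rn JD mD2.
have /fintype.subsetPn[t tJ /fixP nt] := nJ.
have [d dD td] : exists2 d, d \in D & t d != d.
  apply: contrapT => nd; apply: nt => d dD; apply/eqP/negP => /negP td.
  by apply: nd; exists d.
rewrite DD2 in dD; have /imsetP[w wD' dw] := dD.
apply/existsP; exists D'; rewrite KD' /=; apply/existsP; exists w.
apply/existsP; exists (s t w); rewrite wD' fs eqxx andbT /=; apply/andP; split.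
  rewrite -(mincore_stab (K := K) (s := s t) rm KD') ?imset_f //.
  by rewrite inE in tJ.
by apply: contraNneq td => ew; have := congr1 fst (fs t w); rewrite -ew /= -dw => /esym/eqP.
Qed.

Lemma core_structure : ergodic_IRS la ->
  vanishing (fun n K => K \subset [1]%g) ->
  exists r, vanishing (fun n K => ~~ at_fixed r K).
Proof.
move=> erg triv0; have [r rk] := core_rank erg triv0; exists r => e e0.
have [N HN] := rk e e0; exists (N + (r + r + 3))%N => n Nn.
have rn : (r + r + 3 <= #|level k n|)%N.
  by rewrite ltnW // (leq_ltn_trans _ (ltn_level k n)) // (leq_trans _ Nn) // leq_addl.
rewrite -[leRHS]addr0 -(core_fixed rk rn).
apply: (@le_trans _ _ (P n (fun K => ~~ at_core r K) + P n (fun K =>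
    [exists D : {set _}, mincore r K D && ~~ (K \subset 'C(D | 'P))]))).
  apply: Pr_or => // K; have [/existsP[D KD] nK|//] := boolP (at_core r K) => /=.
  apply/existsP; exists D; rewrite KD /=; apply: contra nK => KC.
  by apply/existsP; exists D; have [-> -> _] := mincoreP _ _ _ KD; rewrite eqxx.
by rewrite lerD2r; apply: HN; rewrite (leq_trans _ Nn) // leq_addr.
Qed.

Definition concentrated_on (N : Sub (SDS k)) r := forall (e : R) n, 0 < e ->
  exists2 m, (n <= m)%N & P m (off_class (base_group N r m)) <= e.

Lemma trivial_or_rare : ergodic_IRS la -> concentrated_on (triv_sub (SDS k)) 0 \/
  vanishing (fun n K => K \subset [1]%g).
Proof.
move=> erg; have [||T1|] := @zero_one_decr (fun n K => K \subset [1]%g) erg; last by right.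
- move=> n m nm H /= /fintype.subsetP H1; apply/fintype.subsetP => s sH.
  have [Y [f [t [_ _ es _]]]] := level_split k nm.
  have /H1 : t s \in trace m H by rewrite -(mem_trace_lift H (esym (es s))).
  rewrite !inE -!(inj_eq (@emb_inj k _)) es !emb1 //.
- by move=> n K u; rewrite -{1}(conjs1g u) conjSg.
left=> e n e0; exists n => //; apply: le_trans (ltW e0).
rewrite -(subrr (1 : R)) -{2}(T1 n) -Pr_law_compl.
apply: Pr_sub => // K; apply: contraTN => K1.
have -> : K :=: 'C(finset.set0 | 'P) :&: trace n (triv_sub (SDS k)).
  rewrite trace_triv; apply/eqP; rewrite finset.eqEsubset finset.subsetI K1 andbT.
  apply/andP; split; first by apply/fintype.subsetP => s _; apply/fixP => x; rewrite inE.
  by apply: fintype.subset_trans (finset.subsetIr _ _) _; rewrite finset.sub1set group1.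
by apply: on_class; [exact: normal_triv|rewrite cards0].
Qed.

(** If [k m.+1] is even, every permutation of level [m] becomes even one level up. So a core at
    level [m.+1] yields the full stabilizer of its projection in the trace at level [m]. *)
Lemma concentrated_even r :
  (forall n, exists2 m, (n <= m)%N & ~~ odd (k m)) ->
  vanishing (fun n K => ~~ at_fixed r K) ->
  concentrated_on (whole_sub (SDS k)) r.
Proof.
move=> even fixed e n e0.
have [N HN] := fixed (e / 2) (divr_gt0 e0 (ltr0Sn _ _)).
have [[|m] mn km] := even (n + N + r + 2).+1; first by rewrite ltn0 in mn.
rewrite ltnS in mn; exists m; first by rewrite (leq_trans _ mn) // -!addnA leq_addr.
have Nm : (N <= m)%N by rewrite (leq_trans _ mn) // -addnA addnAC leq_addl.
have rm : (r + 2 <= #|level k m|)%N.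
  by rewrite ltnW // (leq_ltn_trans _ (ltn_level k m)) // (leq_trans _ mn) // -addnA leq_addl.
rewrite [e]splitr; apply: le_trans (lerD (HN m Nm) (HN m.+1 (leqW Nm))).
have lift (Q : pred {set {perm level k m}}) :
    P m Q = P m.+1 (fun K : {set {perm level k m.+1}} => Q (@stretch k m @^-1: K)).
  apply: Pr_law_eq; apply/seteqP.
  by split=> H; rewrite /cyl /= (@trace_preim _ m m.+1 (@stretch k m)) //;
    exact: emb_stretch.
rewrite !lift; apply: Pr_or => // K offK; set J := @stretch k m @^-1: K in offK *.
have [/existsP[D /and3P[/eqP Dr _ JC]]|//] := boolP (at_fixed r J).
have [/existsP[D' /and3P[/eqP D'r /fintype.subsetP KD' _]]|//] := boolP (at_fixed r K).
pose D2 := [set w.1 | w in D']%SET.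
have CJ : 'C(D2 | 'P) \subset J.
  apply/fintype.subsetP => s /fixP fs; rewrite inE; apply: KD'; apply/altfixP; split.
    by move=> [w i] wD; rewrite permE /stretch_fun /= fs //; apply/imsetP; exists (w, i).
  by rewrite Alt_even odd_stretch (negbTE km).
(* Otherwise the trace would contain a transposition moving a point of [D], although it fixes
   [D]. *)
have DD2 : D \subset D2.
  apply/fintype.subsetP => d dD; apply: contraT => dD2.
  have : (0 < #|~: (d |: D2)|)%N.
    rewrite -(ltn_add2l #|d |: D2|) addn0 cardsC (leq_trans _ rm) // addn2 ltnS.
    rewrite cardsU1 dD2 add1n ltnS -D'r; exact: leq_imset_card.
  case/card_gt0P=> z; rewrite !inE negb_or => /andP[zd zD2].
  have : tperm d z \in J.
    apply: (fintype.subsetP CJ); apply/fixP => x xD2.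
    by rewrite tpermD //; [apply: contraNneq dD2 => ->|apply: contraNneq zD2 => ->].
  move=> /(fintype.subsetP JC)/fixP/(_ d dD); rewrite tpermL => zd'.
  by rewrite zd' eqxx in zd.
have eD : D = D2.
  by apply/eqP; rewrite eqEcard DD2 Dr -D'r leq_imset_card.
have JE : J = 'C(D | 'P) by apply/eqP; rewrite finset.eqEsubset JC eD CJ.
have := on_class (@normal_whole k) Dr; rewrite trace_whole finset.setIT -JE.
by rewrite offK.
Qed.

(** The zero-one law for containment in the even subgroup selects, in [core_even_or_full], the same
    alternative at all high levels. *)
Lemma concentrated_odd r n0 : ergodic_IRS la ->
  (forall m, (n0 < m)%N -> odd (k m)) ->
  vanishing (fun n K => ~~ at_fixed r K) ->
  concentrated_on (alt_sub k) r \/ concentrated_on (whole_sub (SDS k)) r.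
Proof.
move=> erg ko fixed.
have altE n : (n0 <= n)%N -> trace n (alt_sub k) = 'Alt_(level k n).
  by move=> nn; apply: trace_alt => m nm; apply: ko; exact: leq_ltn_trans nm.
have [||A1|A0] := @zero_one_decr (fun n K => K \subset trace n (alt_sub k)) erg.
- move=> n m nm H /= /fintype.subsetP H1; apply/fintype.subsetP => s sH.
  have [Y [f [t [_ _ es _]]]] := level_split k nm.
  rewrite (mem_trace_lift _ (esym (es s))); apply: H1.
  by rewrite -(mem_trace_lift H (esym (es s))).
- by move=> n K u; rewrite -{1}(trace_normal u (@normal_alt k)) conjSg.
- left=> e n e0; have [N HN] := fixed e e0; pose m := (n + N + n0)%N.
  have Nm : (N <= m)%N by rewrite /m addnAC leq_addl.
  have n0m : (n0 <= m)%N by rewrite /m leq_addl.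
  exists m; first by rewrite /m -addnA leq_addr.
  apply: le_trans (HN m Nm).
  rewrite -[leRHS]addr0 -(subrr (1 : R)) -{2}(A1 m) -Pr_law_compl; apply: Pr_or => // K offK.
  have [/existsP[D /and3P[/eqP Dr KD KC]]|//] /= := boolP (at_fixed r K).
  apply: contraL offK => KA; have := core_even_or_full KD KC.
  by rewrite -(altE m n0m) KA => ->; apply: on_class => //; exact: normal_alt.
- right=> e n e0; have [N HN] := fixed (e / 2) (divr_gt0 e0 (ltr0Sn _ _)).
  have [N' HN'] := A0 (e / 2) (divr_gt0 e0 (ltr0Sn _ _)).
  pose m := (n + N + (N' + n0))%N.
  have Nm : (N <= m)%N by rewrite /m addnAC leq_addl.
  have N'm : (N' <= m)%N by rewrite /m addnCA leq_addr.
  have n0m : (n0 <= m)%N by rewrite /m addnA leq_addl.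
  exists m; first by rewrite /m -addnA leq_addr.
  rewrite [e]splitr; apply: le_trans (lerD (HN m Nm) (HN' m N'm)).
  apply: Pr_or => // K offK.
  have [/existsP[D /and3P[/eqP Dr KD KC]]|//] /= := boolP (at_fixed r K).
  apply: contraLR offK => KA; have := core_even_or_full KD KC.
  rewrite -(altE m n0m) (negbTE KA) => ->.
  by have := on_class (@normal_whole k) Dr; rewrite trace_whole finset.setIT.
Qed.

End Random.

(** * Stabilizer distributions of random points *)

(** At most a proportion [r * r / n] of the [r]-tuples in [n] points has a repetition; multiplying
    out by [n] avoids division. *)
Lemma expn_ffact n r : (n ^ r * n <= n ^_ r * n + r * r * n ^ r)%N.
Proof.
elim: r => [|r IH]; first by rewrite ffactn0 expn0 mul0n addn0.
have fr : (n ^_ r <= n ^ r)%N.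
  elim: r {IH} => [|r IH]; first by rewrite ffactn0.
  by rewrite ffactnSr expnSr leq_mul // leq_subr.
rewrite ffactnSr expnS; move: IH fr; move: (n ^_ r)%N (n ^ r)%N => a b IH ab.
have : (a * n <= a * (n - r) + a * r)%N by rewrite -mulnDr leq_mul2l; lia.
nia.
Qed.

Section Prefix.
Variables (R : realType) (k : branching).
Local Notation MS := (mseqspace k).
Local Notation BS := (BSub (SDS k)).

Lemma measurable_coord i (a : 'I_(k i)) : measurable [set x : MS | x i = a].
Proof. by apply: sub_sigma_algebra; exists i, [set a]. Qed.

Lemma prefixE n (v : level k n) : [set x : MS | prefix n x = v] =
  [set x | forall i, (i < n.+1)%N -> [set graft v point i] (x i)].
Proof.
apply/seteqP; split=> x /=.
  by move=> xv i; rewrite ltnS; apply: (proj1 (eq_prefix n x _)); rewrite prefix_graft.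
by move=> xv; rewrite -[RHS](prefix_graft v point); apply/eq_prefix => i /xv.
Qed.

Lemma measurable_prefix n (v : level k n) : measurable [set x : MS | prefix n x = v].
Proof.
rewrite prefixE (_ : [set x | _] = \bigcap_(i in [set i | (i < n.+1)%N])
    [set x : MS | x i = graft v point i]); last by apply/seteqP; split=> x.
by apply: bigcap_measurable => [|i _]; [exists 0%N | exact: measurable_coord].
Qed.

Lemma product_mu_prefix n (v : level k n) :
  product_mu k R [set x : MS | prefix n x = v] = (#|level k n|%:R^-1)%:E.
Proof.
rewrite prefixE (@product_muP k R n.+1 (fun i => [set graft v point i])).
congr (_%:E); rewrite card_level natr_prod -prodfV; apply: eq_bigr => i _.
rewrite /uniform_mass (_ : #|_| = 1%N) ?div1r //.
by apply/eqP/card1P; exists (graft v point i : 'I_(k i)) => j; rewrite !inE; apply/asboolP/eqP.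
Qed.

Variable r : nat.
Let Q := power_measure (product_mu k R) r.

Definition prefixes n (t : r.-tuple MS) : {ffun 'I_r -> level k n} :=
  [ffun i => prefix n (tnth t i)].

Lemma prefixesE n (w : {ffun 'I_r -> level k n}) :
  [set t | prefixes n t = w] = [set t | forall i, [set x : MS | prefix n x = w i] (tnth t i)].
Proof.
apply/seteqP; split=> t /=; first by move=> <- i; rewrite ffunE.
by move=> tw; apply/ffunP => i; rewrite ffunE.
Qed.

Lemma measurable_prefixes n (w : {ffun 'I_r -> level k n}) :
  measurable [set t | prefixes n t = w].
Proof.
rewrite prefixesE (_ : [set t | _] = \bigcap_(i in [set: 'I_r])
   ((fun t : r.-tuple MS => tnth t i) @^-1` [set x : MS | prefix n x = w i])); last first.
  by apply/seteqP; split=> t /= tw i => [_|]; exact: tw.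
apply: fin_bigcap_measurable => [|i _]; first exact: finite_finset.
rewrite -[X in measurable X]setTI; apply: measurable_tnth => //.
exact: measurable_prefix.
Qed.

(** The [r] prefixes are independent and uniform on the level, so events about them reduce to
    counting. *)
Lemma prefixes_law n (S : pred {ffun 'I_r -> level k n}) :
  measurable [set t | S (prefixes n t)] /\
  Q [set t | S (prefixes n t)] = ((\sum_w (S w)%:R) / #|level k n|%:R ^+ r)%:E.
Proof.
have -> : [set t | S (prefixes n t)] = \bigcup_(w in [set` S]) [set t | prefixes n t = w].
  apply/seteqP; split=> t /=; first by move=> St; exists (prefixes n t).
  by move=> [w Sw ->].
split.
  by apply: fin_bigcup_measurable => [|w _];
    [exact: finite_finset|exact: measurable_prefixes].
rewrite measure_fin_bigcup; last by move=> w _; exact: measurable_prefixes.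
- rewrite -(@bigfs _ _ _ _ (index_enum {ffun 'I_r -> level k n})) ?index_enum_uniq //.
  2: by move=> w _; rewrite mem_index_enum.
  rewrite mulr_suml -sumEFin big_mkcond; apply: eq_bigr => w _.
  case: (S w); last by rewrite mul0r.
  have E := @power_measureP _ _ R (product_mu k R) r (fun i => [set x : MS | prefix n x = w i])
    (fun i => measurable_prefix (w i)).
  rewrite prefixesE; apply: (etrans E).
  under eq_bigr do rewrite product_mu_prefix.
  by rewrite prodEFin prodr_const card_ord mul1r exprVn.
- exact: finite_finset.
- by move=> w w' _ _ [t [/= <- <-]].
Qed.

Variable N : Sub (SDS k).

(** A common form: [N] the whole group gives [sigma], [N] the even subgroup gives [sigma_alt], and
    [r = 0] gives the Dirac measure at [N]. *)
Definition stab_in (t : r.-tuple MS) : BS := cap_sub (stab_sub t) N.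

Definition fixer n (w : {ffun 'I_r -> level k n}) : {set {perm level k n}} :=
  'C([set w i | i : 'I_r]%SET | 'P) :&: trace n N.

Lemma trace_stab_in n t : trace n (stab_in t) = fixer (prefixes n t).
Proof.
rewrite /stab_in trace_cap trace_stab /fixer; congr ('C(_ | _) :&: _).
by apply: eq_imset => i; rewrite ffunE.
Qed.

Lemma preimage_stab_in n (S : pred {set {perm level k n}}) :
  stab_in @^-1` cyl S = [set t | S (fixer (prefixes n t))].
Proof. by apply/seteqP; split=> t; rewrite /cyl /= trace_stab_in. Qed.

Lemma measurable_stab_in : measurable_fun [set: r.-tuple MS] stab_in.
Proof.
apply: measurable_cyl_preimage => n S; rewrite preimage_stab_in.
by have [] := prefixes_law (fun w => S (fixer w)).
Qed.

Let stab_in_mfun : {mfun r.-tuple MS >-> BS} := mfun_Sub (mem_set measurable_stab_in).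

Definition rho : probability BS R := distribution Q stab_in_mfun.

Lemma rhoE A : rho A = Q (stab_in @^-1` A).
Proof. by []. Qed.

Lemma rho_cyl n (S : pred {set {perm level k n}}) :
  rho (cyl S) = ((\sum_w (S (fixer w))%:R) / #|level k n|%:R ^+ r)%:E.
Proof. by rewrite rhoE preimage_stab_in; have [] := prefixes_law (fun w => S (fixer w)). Qed.

Hypothesis NN : normal_sub N.

Lemma fixerJ n (w : {ffun 'I_r -> level k n}) (u : {perm level k n}) :
  fixer [ffun i => u (w i)] = fixer w :^ u.
Proof.
rewrite /fixer conjIg -fixJ trace_normal //; congr ('C(_ | _) :&: _).
by rewrite -imset_comp; apply: eq_imset => i; rewrite ffunE.
Qed.

(** On cylinders of a level containing [g], conjugation only permutes the equally likely tuples of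
    prefixes. *)
Lemma rho_IRS : IRS rho.
Proof.
move=> g A mA.
pose f : {mfun BS >-> BS} := mfun_Sub (mem_set (measurable_conj_sub g)).
apply: (cyl_measure_unique (m1 := distribution rho f) (m2 := rho)) => //.
  have := probability_setT (distribution rho f : probability _ _).
  by move=> /= ->; rewrite ltry.
move=> n S; have [m [u [nm gu]]] := emb_level n g; have [S' ->] := cyl_lift S nm.
transitivity (rho (cyl (fun K => S' (K :^ u^-1)))).
  by rewrite -conj_cyl -gu.
apply: (etrans _ (esym (rho_cyl S'))); rewrite rho_cyl; congr (_%:E); congr (_ / _)%R.
have uI : injective (fun w : {ffun 'I_r -> level k m} => [ffun i => (u^-1)%g (w i)]).
  by move=> w w' /ffunP e; apply/ffunP => i; have := e i; rewrite !ffunE => /perm_inj.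
rewrite [RHS](reindex_inj uI); apply: eq_bigr => w _.
by rewrite fixerJ.
Qed.

(** When the [r] prefixes are distinct the trace lies in the reference class, and by [expn_ffact]
    they coincide only with probability at most [r * r / #|level k n|]. *)
Lemma rho_concentrated (e : R) : 0 < e -> exists n0, forall n, (n0 <= n)%N ->
  (rho (cyl (off_class (base_group N r n))) <= e%:E)%E.
Proof.
move=> e0; exists (Num.truncn ((r * r)%:R / e)).+1 => n nn.
pose X := #|level k n|; have X0 : 0 < X%:R :> R by rewrite ltr0n level_gt0.
rewrite rho_cyl lee_fin ler_pdivrMr ?exprn_gt0 //.
have Xe : (r * r)%:R <= e * X%:R.
  rewrite mulrC -ler_pdivrMr // (@le_trans _ _ (Num.truncn ((r * r)%:R / e)).+1%:R) //.
    by rewrite ltW // truncnS_gt.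
  by rewrite ler_nat (leq_trans nn) // ltnW // ltn_level.
pose D := (\sum_(w : {ffun 'I_r -> level k n}) ~~ injectiveb w)%N.
have DX : (D + X ^_ r = X ^ r)%N.
  rewrite -[in RHS](card_ord r) -card_ffun -[in LHS](card_ord r) -card_inj_ffuns.
  rewrite -sum1_card [in X in (_ + X)%N]big_mkcond -big_split -sum1_card.
  by apply: eq_bigr => w _; rewrite inE; case: injectiveb.
apply: (@le_trans _ _ D%:R).
  rewrite -natr_sum ler_nat; apply: leq_sum => w _.
  case: (boolP (injectiveb w)) => [/injectiveP wI|_]; last by case: off_class.
  by rewrite (negbTE (on_class NN _)) // card_imset // card_ord.
have : (D * X <= r * r * X ^ r)%N by have := expn_ffact X r; rewrite -{1}DX mulnDl; lia.
rewrite -(ler_nat R) [X in X <= _]natrM [X in _ <= X]natrM natrX => H.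
by rewrite -(ler_pM2r X0) (le_trans H) // mulrAC ler_wpM2r.
Qed.

End Prefix.

(** * The even subgroup, Dirac measures and the parity alternative *)

Section Simplicity.
Variables (R : realType) (k : branching).

Lemma alt_proper n0 : (forall m, (n0 < m)%N -> odd (k m)) ->
  ~ simple_group (SDS k).
Proof.
(* This level has more than two points, so it carries a three-cycle, which is even and nontrivial,
   and a transposition, which is odd. *)
move=> ko [_ simpleG]; pose n := n0.+2.
have altE : trace n (alt_sub k) = 'Alt_(level k n).
  by apply: trace_alt => m nm; apply: ko; apply: ltn_trans nm; rewrite /n.
have /card_gt2P[a [b [c [_ [ab bc ca]]]]] : (2 < #|level k n|)%N.
  exact: leq_ltn_trans (ltn_level k n).
have [E|E] := simpleG _ (@normal_alt k).
- have : c3 a b c \in trace n (alt_sub k) by rewrite altE c3_even // eq_sym.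
  rewrite E trace_triv inE => /eqP/(congr1 (fun s : {perm _} => s a)).
  rewrite perm1 c3E 1?eq_sym // ?eqxx; last by rewrite eq_sym.
  by move=> ba; rewrite ba eqxx in ab.
- have : tperm a b \in trace n (alt_sub k) by rewrite E trace_whole inE.
  by rewrite altE Alt_even odd_tperm ab.
Qed.

Lemma rho0 (N : Sub (SDS k)) A : rho R 0 N A = dirac (N : BSub (SDS k)) A.
Proof.
rewrite rhoE diracE.
have sN (t : 0.-tuple (mseqspace k)) : stab_in N t = N.
  apply: Sub_ext => g; rewrite unfold_in /= andb_idl // => _.
  by rewrite unfold_in; apply/asboolP => -[].
case: (boolP (N \in A)) => NA.
  rewrite (_ : _ @^-1` _ = setT) ?probability_setT //.
  by apply/seteqP; split=> t // _; rewrite /preimage /= sN; exact: set_mem.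
rewrite (_ : _ @^-1` _ = set0) ?measure0 //.
apply/seteqP; split=> t //; rewrite /preimage /= sN => /mem_set.
by rewrite (negbTE NA).
Qed.

Lemma even_or_odd : (forall n, exists2 m, (n <= m)%N & ~~ odd (k m)) \/
  exists n0, forall m, (n0 < m)%N -> odd (k m).
Proof.
have [|nE] := pselect (forall n, exists2 m, (n <= m)%N & ~~ odd (k m)); first by left.
right; apply: contrapT => nO; apply: nE => n; apply: contrapT => nm.
apply: nO; exists n => m mn; apply: contraT => km; case: nm.
by exists m => //; exact: ltnW.
Qed.

End Simplicity.

(** * Classification of the ergodic measures *)

Section Classification.
Variables (R : realType) (k : branching).
Implicit Type la : probability (BSub (SDS k)) R.

Lemma rho_ergodic la N r : normal_sub N -> same_measure la (rho R r N) ->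
  ergodic_IRS la.
Proof.
move=> NN laE; apply: (concentrated_ergodic (K0 := base_group N r)).
  move=> g A mA; rewrite /pushforward !laE //; first exact: rho_IRS.
  by rewrite -[X in measurable X]setTI; exact: (measurable_conj_sub g measurableT mA).
move=> e n e0; have [n0 Hn0] := @rho_concentrated R k r N NN e e0.
exists (n + n0)%N; first exact: leq_addr.
by rewrite laE; [apply: Hn0; exact: leq_addl|exact: measurable_cyl].
Qed.

Lemma concentrated_rho la N r : normal_sub N -> IRS la -> concentrated_on la N r ->
  same_measure la (rho R r N).
Proof.
move=> NN laJ conc A mA.
apply: (concentrated_unique (c := 1) (K0 := base_group N r) (mu := la)
  (nu := rho R r N)) => //.
- exact: rho_IRS.
- exact: probability_setT.
- exact: probability_setT.
move=> e n e0; have [n0 Hn0] := @rho_concentrated R k r N NN e e0.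
have [m nm le] := conc e (n + n0)%N e0; exists m; split.
- by rewrite (leq_trans _ nm) // leq_addr.
- by have := prob_cyl la (off_class (base_group N r m)) => /= ->; rewrite lee_fin.
- by apply: Hn0; rewrite (leq_trans _ nm) // leq_addl.
Qed.

Lemma sigmaE r : sigma R k r = rho R r (whole_sub (SDS k)) :> (set _ -> _).
Proof.
apply/funext => A; rewrite /sigma /pushforward rhoE; congr (power_measure _ _ _).
apply/seteqP; split=> t;
  rewrite /preimage /= /stab_in (_ : cap_sub _ _ = stab_sub t) //;
  by apply: Sub_ext => g; rewrite unfold_in /= andbT.
Qed.

Lemma sigma_altE r : sigma_alt R k r = rho R r (alt_sub k) :> (set _ -> _).
Proof. by apply/funext => A; rewrite /sigma_alt /pushforward rhoE. Qed.

Lemma rho_dirac la (N : Sub (SDS k)) :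
  same_measure la (rho R 0 N) <-> same_measure la (dirac (N : BSub (SDS k))).
Proof. by split=> H A mA; rewrite H // rho0. Qed.

Lemma rho_cases la N (sg : nat -> set (BSub (SDS k)) -> \bar R) :
  (forall r, sg r = rho R r N) ->
  (exists r, same_measure la (rho R r N)) <->
  same_measure la (dirac (N : BSub (SDS k))) \/
  exists2 r : nat, (0 < r)%N & same_measure la (sg r).
Proof.
move=> sgE; split=> [[[|r]]|[|[r _]]].
- by left; exact/rho_dirac.
- by right; exists r.+1 => //; rewrite sgE.
- by move/rho_dirac; exists 0%N.
- by rewrite sgE; exists r.
Qed.

(** The even alternative keeps the parity condition on [k], from which [alt_proper] excludes it in a
    simple group. *)
Lemma ergodic_rho la : ergodic_IRS la ->
  same_measure la (dirac (triv_sub (SDS k) : BSub (SDS k))) \/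
  exists r, same_measure la (rho R r (whole_sub (SDS k))) \/
    ((exists n0, forall m, (n0 < m)%N -> odd (k m)) /\
     same_measure la (rho R r (alt_sub k))).
Proof.
move=> erg; have [laJ _] := erg.
have [triv|triv] := trivial_or_rare laJ erg.
  by left; apply/rho_dirac; apply: concentrated_rho => //; exact: normal_triv.
right; have [r fixed] := core_structure laJ erg triv; exists r.
have [even|[n0 ko]] := even_or_odd k.
  left; apply: concentrated_rho (concentrated_even laJ even fixed) => //.
  exact: normal_whole.
have [alt|whole] := concentrated_odd laJ erg ko fixed.
  right; split; first by exists n0.
  by apply: concentrated_rho => //; exact: normal_alt.
by left; apply: concentrated_rho => //; exact: normal_whole.
Qed.

End Classification.

Theorem theorem1p1 (R : realType) (k : branching) :
  (simple_group (SDS k) ->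
    forall lambda : probability (BSub (SDS k)) R,
      ergodic_IRS lambda <->
      [\/ same_measure lambda (dirac (triv_sub (SDS k) : BSub (SDS k))),
          same_measure lambda (dirac (whole_sub (SDS k) : BSub (SDS k)))
        | exists2 r : nat, (0 < r)%N & same_measure lambda (sigma R k r)]) /\
  (~ simple_group (SDS k) ->
    forall lambda : probability (BSub (SDS k)) R,
      ergodic_IRS lambda <->
      [\/ [\/ same_measure lambda (dirac (triv_sub (SDS k) : BSub (SDS k))),
              same_measure lambda (dirac (alt_sub k : BSub (SDS k)))
            | same_measure lambda (dirac (whole_sub (SDS k) : BSub (SDS k)))],
          exists2 r : nat, (0 < r)%N & same_measure lambda (sigma R k r)
        | exists2 r : nat, (0 < r)%N & same_measure lambda (sigma_alt R k r)]).
Proof.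
have whole la := rho_cases la (sigmaE R k); have alt la := rho_cases la (sigma_altE R k).
have triv_erg (la : probability (BSub (SDS k)) R) :
    same_measure la (dirac (triv_sub (SDS k) : BSub (SDS k))) -> ergodic_IRS la.
  by move/rho_dirac; apply: rho_ergodic; exact: normal_triv.
have whole_erg (la : probability (BSub (SDS k)) R) r :
    same_measure la (rho R r (whole_sub (SDS k))) -> ergodic_IRS la.
  by apply: rho_ergodic; exact: normal_whole.
have alt_erg (la : probability (BSub (SDS k)) R) r :
    same_measure la (rho R r (alt_sub k)) -> ergodic_IRS la.
  by apply: rho_ergodic; exact: normal_alt.
split=> simpleG la; split.
- move=> /ergodic_rho[|[r [laE|[[n0 ko] _]]]]; first by constructor 1.
    by have [|] := (whole la).1 (ex_intro _ r laE); [constructor 2|constructor 3].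
  (* Here the even subgroup would be proper, nontrivial and normal. *)
  by have := alt_proper ko simpleG.
- case=> [/triv_erg//|d|s].
    by have [r /whole_erg] := (whole la).2 (or_introl d).
  by have [r /whole_erg] := (whole la).2 (or_intror s).
- move=> /ergodic_rho[|[r [laE|[_ laE]]]]; first by constructor 1; constructor 1.
    by have [|] := (whole la).1 (ex_intro _ r laE);
      [constructor 1; constructor 3|constructor 2].
  by have [|] := (alt la).1 (ex_intro _ r laE); [constructor 1; constructor 2|constructor 3].
- case=> [[/triv_erg//|d|d]|s|s].
  + by have [r /alt_erg] := (alt la).2 (or_introl d).
  + by have [r /whole_erg] := (whole la).2 (or_introl d).
  + by have [r /whole_erg] := (whole la).2 (or_intror s).
  + by have [r /alt_erg] := (alt la).2 (or_intror s).
Qed.
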